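(* Let $\varepsilon>0$. There is a function $f(n)$ with $f(n)/(n\log^2 n)\to\infty$ as $n\to\infty$ such that, with probability at least $1-\exp(-f(n))$, a uniformly random Latin square of order $n$ has no proper subsquare of order larger than $n^{1/2}(\log n)^{1/2+\varepsilon}$.
   Context: A Latin square of order $n$ is an $n\times n$ array with symbols from an $n$-set in which each symbol occurs exactly once in each row and column. A subsquare is a subarray (on some set of rows and some set of columns) which is itself a Latin square; it is proper if its order is at least $2$ and less than $n$. The probability is with respect to the uniform distribution on Latin squares of order $n$ with symbol set $[n]$. *)

(* Defs.v *)
From mathcomp Require Import all_boot all_order all_algebra.
From mathcomp Require Import reals.

Set Implicit Arguments.
Unset Strict Implicit.
Unset Printing Implicit Defensive.

Import Order.TTheory GRing.Theory Num.Theory.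

Local Open Scope ring_scope.

Definition latin_subarray (n : nat) (L : 'M['I_n]_n) (A B S : {set 'I_n})
    : bool :=
  [&& #|B| == #|A|, #|S| == #|A|,
      [forall i in A, forall j in B, L i j \in S],
      [forall i in A, forall s in S, #|[set j in B | L i j == s]| == 1%N]
    & [forall j in B, forall s in S, #|[set i in A | L i j == s]| == 1%N]].

Definition latin_square (n : nat) (L : 'M['I_n]_n) : bool :=
  latin_subarray L [set: 'I_n] [set: 'I_n] [set: 'I_n].

(* The symbol set of a subsquare need not be {0, ..., k-1}: any k-set of
   symbols is allowed.  The order of the subsquare on rows A is #|A|. *)
Definition subsquare (n : nat) (L : 'M['I_n]_n) (A B : {set 'I_n}) : bool :=
  [exists S : {set 'I_n}, latin_subarray L A B S].

Definition proper_subsquare (n : nat) (L : 'M['I_n]_n) (A B : {set 'I_n})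
    : bool :=
  subsquare L A B && (2 <= #|A| < n)%N.

Definition has_proper_subsquare_gt (R : realType) (n : nat) (x : R)
    (L : 'M['I_n]_n) : bool :=
  [exists A : {set 'I_n}, exists B : {set 'I_n},
     proper_subsquare L A B && (x < #|A|%:R)].

Definition latin_squares (n : nat) : {set 'M['I_n]_n} :=
  [set L | latin_square L].

Definition finset_uniform_prob (R : realType) (T : finType) (X : {set T})
    (E : pred T) : R :=
  #|[set x in X | E x]|%:R / #|X|%:R.

(* Main.v *)
(* Writing L(n) for the number of Latin squares of order n, both L(n) and the
   number of Latin squares with a subsquare on prescribed rows A, columns B and
   symbols S are estimated by adding one row at a time: the candidates for the
   next row are the perfect matchings of a bipartite graph.

   - Lower bound.  A regular graph of degree r on n + n vertices has at least
     (r/(n+1))^n n! perfect matchings (van der Waerden up to a factor e).  This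
     follows Gurvits: the permanent is reached from prod_i (A x)_i by n
     successive directional derivatives, stability (no zero with all imaginary
     parts positive) makes each restriction to a line real-rooted, and by AM-GM
     each derivative costs the capacity a controlled factor.
   - Upper bound.  Bregman's inequality, in Schrijver's entropy proof.  The rows
     of A come first; their candidates split into a matching of B with S and one
     of the complements, of degrees m - j and n - m - j where m = |A|.

   Comparing the two bounds factor by factor, the j-th row of A loses
   (m/n)^m up to an error exp(O(m ln n / (m - j))), and every row carries an
   error exp(O(n ln n / (n - j))).  So the probability of a subsquare on given
   (A, B, S) is at most exp(O(n ln^2 n) - m^2 ln(n/m)).  As m <= n/2 and
   m^2 > n (ln n)^(1 + 2 eps), the exponent is below -n (ln n)^(2 + eps) for
   large n, which absorbs the union bound over at most 8^n triples. *)

Require Import Defs.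
From mathcomp Require Import all_classical all_reals all_analysis.
From mathcomp Require Import all_boot all_order all_algebra all_fingroup all_field.
From mathcomp Require Import ring lra zify.

Set Implicit Arguments.
Unset Strict Implicit.
Unset Printing Implicit Defensive.

Import Order.TTheory GRing.Theory Num.Theory.
Import numFieldNormedType.Exports.

Local Open Scope ring_scope.

(** * Perfect matchings of regular bipartite graphs *)

Lemma coef01_prod_linear (C : comNzRingType) (r : seq C) :
  let p := \prod_(c <- r) (1 - c *: 'X) : {poly C} in
  p`_0 = 1 /\ p`_1 = - \sum_(c <- r) c.
Proof.
elim: r => [|c r [IH0 IH1]] /=; first by rewrite !big_nil !coefE oppr0.
rewrite !big_cons mulrBl mul1r -scalerAl !(coefB, coefZ, coefXM) /= IH0 IH1.
by rewrite mulr0 subr0 mulr1 opprD addrC.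
Qed.

(** Since 0 is not a root, each linear factor can be normalised to 1 - X/z. The roots then enter
    only through their inverses, whose sum is minus the logarithmic derivative of [p] at 0. *)
Lemma poly_factor_at0 (C : closedFieldType) (p : {poly C}) : p`_0 != 0 ->
  exists r : seq C,
    [/\ size r = (size p).-1,
        forall z, z \in r -> root p z,
        p`_1 = - p`_0 * \sum_(z <- r) z^-1 &
        forall t, p.[t] = p`_0 * \prod_(z <- r) (1 - t / z)].
Proof.
move=> p0; have [r pE] := closed_field_poly_normal p.
have lp : lead_coef p != 0.
  by rewrite lead_coef_eq0; apply: contraNneq p0 => ->; rewrite coef0.
have rootr z : z \in r -> root p z.
  by move=> zr; rewrite pE rootZ // root_prod_XsubC.
have rn0 z : z \in r -> z != 0.
  by move=> /rootr; apply: contraTneq => ->; rewrite rootE horner_coef0.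
have pE' : p = p`_0 *: \prod_(c <- [seq z^-1 | z <- r]) (1 - c *: 'X).
  have E : \prod_(z <- r) ('X - z%:P) =
      (\prod_(z <- r) (- z)) *: \prod_(c <- [seq z^-1 | z <- r]) (1 - c *: 'X).
    rewrite big_map.
    elim: r rn0 {pE rootr} => [|z r IH] rn0; first by rewrite !big_nil scale1r.
    rewrite !big_cons IH; last by move=> y yr; apply: rn0; rewrite inE yr orbT.
    have -> : 'X - z%:P = (- z) *: (1 - z^-1 *: 'X).
      rewrite scalerBr scalerA mulNr mulfV ?rn0 ?mem_head//.
      by rewrite scaleN1r opprK addrC scaleNr alg_polyC.
    by rewrite -scalerAl -scalerAr scalerA.
  have c0 : p`_0 = lead_coef p * \prod_(z <- r) (- z).
    rewrite [in LHS]pE E !coefZ; have [-> _] := coef01_prod_linear [seq z^-1 | z <- r].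
    by rewrite mulr1.
  by rewrite [LHS]pE E scalerA c0.
exists r; split => //.
- by rewrite pE size_scale // size_prod_XsubC.
- rewrite {1}pE' coefZ; have [_ ->] := coef01_prod_linear [seq z^-1 | z <- r].
  by rewrite big_map mulrN mulNr.
move=> t; rewrite {1}pE' hornerZ horner_prod big_map; congr (_ * _).
by apply: eq_bigr => z _; rewrite !hornerE mulrC.
Qed.

(* The permanent of [a] with each of its first [k] columns replaced by [w]:
   [k`!] times the derivative of [\prod_i w i] along the columns [j >= k]. *)
Definition col_per (C : comNzRingType) (n : nat) (a : 'I_n -> 'I_n -> C)
    (k : nat) (w : 'I_n -> C) : C :=
  \sum_(s : 'S_n) \prod_(j < n) (if (j < k)%N then w (s j) else a (s j) j).

Definition col_per_line (C : comNzRingType) (n : nat) (a : 'I_n -> 'I_n -> C)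
    (k : nat) (w u : 'I_n -> C) : {poly C} :=
  col_per (fun i j => (a i j)%:P) k (fun i => (w i)%:P + u i *: 'X).

Lemma eq_col_per (C : comNzRingType) (n : nat) (a : 'I_n -> 'I_n -> C) k w w' :
  (forall i, w i = w' i) -> col_per a k w = col_per a k w'.
Proof.
move=> E; apply: eq_bigr => s _; apply: eq_bigr => j _; by rewrite E.
Qed.

Lemma horner_col_per_line (C : comNzRingType) (n : nat) (a : 'I_n -> 'I_n -> C)
    k w u t :
  (col_per_line a k w u).[t] = col_per a k (fun i => w i + t * u i).
Proof.
rewrite /col_per_line /col_per horner_sum; apply: eq_bigr => s _.
rewrite horner_prod; apply: eq_bigr => j _.
by case: ifP => _; rewrite !hornerE // mulrC.
Qed.

Lemma coef0_col_per_line (C : comNzRingType) (n : nat) (a : 'I_n -> 'I_n -> C)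
    k w u :
  (col_per_line a k w u)`_0 = col_per a k w.
Proof.
rewrite -horner_coef0 horner_col_per_line.
by apply: eq_col_per => i; rewrite mul0r addr0.
Qed.

Lemma deriv_prod_ord (C : comNzRingType) n (F : 'I_n -> {poly C}) :
  (\prod_i F i)^`() = \sum_j (F j)^`() * \prod_(i | i != j) F i.
Proof.
elim: n F => [|n IH] F; first by rewrite !big_ord0 derivC.
rewrite big_ord_recl derivM IH big_ord_recl; congr (_ + _).
  congr (_ * _); rewrite [in RHS]big_mkcond big_ord_recl /= mul1r.
  by apply: eq_bigr => i _.
rewrite mulr_sumr; apply: eq_bigr => j _.
rewrite [in RHS]big_mkcond big_ord_recl /= mulrCA; congr (_ * (_ * _)).
by rewrite big_mkcond; apply: eq_bigr => i _; rewrite (inj_eq lift_inj).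
Qed.

(** The product rule gives one term for each replaced column [j], namely the one where [a i k] takes
    the place of [w i]. Composing the permutation with the transposition of [j] and [k] shows that
    these [k.+1] terms are equal. *)
Lemma coef1_col_per_line (C : comNzRingType) (n : nat) (a : 'I_n -> 'I_n -> C)
    (k : 'I_n) w :
  (col_per_line a k.+1 w (fun i => a i k))`_1 = col_per a k w *+ k.+1.
Proof.
set p := col_per_line _ _ _ _.
have -> : p`_1 = p^`().[0] by rewrite horner_coef0 coef_deriv mulr1n.
pose h (s : 'S_n) (i : 'I_n) := if (i < k.+1)%N then w (s i) else a (s i) i.
pose T (j : 'I_n) := \sum_(s : 'S_n) a (s j) k * \prod_(i | i != j) h s i.
have -> : p^`().[0] = \sum_(j < n | (j < k.+1)%N) T j.
  rewrite /p /col_per_line /col_per raddf_sum horner_sum /T exchange_big /=.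
  apply: eq_bigr => s _; rewrite deriv_prod_ord horner_sum [RHS]big_mkcond /=.
  apply: eq_bigr => j _; rewrite hornerM horner_prod.
  have -> : \prod_(i | i != j) (if (i < k.+1)%N then (w (s i))%:P + a (s i) k *: 'X
      else (a (s i) i)%:P).[0] = \prod_(i | i != j) h s i.
    by apply: eq_bigr => i _; rewrite /h; case: ifP => _; rewrite !hornerE ?mulr0 ?addr0.
  case: ifP => _; last by rewrite derivC horner0 mul0r.
  by rewrite derivD derivC derivZ derivX add0r !hornerE.
have TE (j : 'I_n) : (j < k.+1)%N -> T j = T k.
  move=> jk; rewrite /T (reindex_inj (mulgI (tperm j k))) /=.
  apply: eq_bigr => s _; rewrite permM tpermL; congr (_ * _).
  rewrite (reindex_inj (@perm_inj _ (tperm j k))) /=.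
  apply: eq_big => i.
    by rewrite (canF_eq (tpermK j k)) tpermL.
  move=> ij; rewrite /h permM tpermK.
  by case: tpermP ij => [->|->|//]; rewrite ?eqxx // jk ltnS leqnn.
rewrite (eq_bigr _ TE) sumr_const; congr (_ *+ _); last first.
  rewrite -sum1_card -(big_ord_widen _ (fun=> 1%N)) ?ltn_ord //.
  by rewrite sum_nat_const card_ord muln1.
apply: eq_bigr => s _; rewrite [RHS](bigD1 k) //= ltnn; congr (_ * _).
by apply: eq_bigr => i ik; rewrite /h ltnS leq_eqVlt (negPf ik : (i == k :> nat) = false).
Qed.

(** Every permutation contributes a polynomial of degree exactly [k] with positive leading
    coefficient, so the top terms cannot cancel. *)
Lemma size_col_per_line (C : numClosedFieldType) (n : nat)
    (a : 'I_n -> 'I_n -> C) (k : nat) w u :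
  (k <= n)%N -> (forall i j, 0 < a i j) -> (forall i, 0 < u i) ->
  size (col_per_line a k w u) = k.+1.
Proof.
move=> kn a0 u0.
pose F (s : 'S_n) (j : 'I_n) : {poly C} :=
  if (j < k)%N then (w (s j))%:P + u (s j) *: 'X else (a (s j) j)%:P.
have szF s j : size (F s j) = (if (j < k)%N then 2 else 1)%N.
  rewrite /F; case: ifP => _; last by rewrite size_polyC gt_eqF.
  rewrite addrC size_polyDl size_scale ?gt_eqF // size_polyX //.
  by rewrite size_polyC; case: eqP.
have ldF s j : 0 < lead_coef (F s j).
  rewrite /F; case: ifP => _; last by rewrite lead_coefC.
  rewrite addrC lead_coefDl ?lead_coefZ ?lead_coefX ?mulr1 //.
  by rewrite size_scale ?gt_eqF // size_polyX size_polyC; case: eqP.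
have nzF s j : F s j != 0 by rewrite -lead_coef_eq0 gt_eqF.
have szP s : size (\prod_(j < n) F s j) = k.+1.
  rewrite size_prod // (eq_bigr (fun j : 'I_n => (1 + (j < k)%N)%N)); last first.
    by move=> j _; rewrite szF; case: (j < k)%N.
  rewrite big_split /= sum1_card -big_mkcond /= sum1_card.
  have -> : #|(fun j : 'I_n => (j < k)%N)| = k.
    rewrite -sum1_card -(big_ord_widen _ (fun=> 1%N)) //.
    by rewrite sum_nat_const card_ord muln1.
  by rewrite -addnS addKn.
have szle : (size (col_per_line a k w u) <= k.+1)%N.
  apply: leq_trans (size_sum _ _ _) _; apply/bigmax_leqP => s _.
  by rewrite -/(F s _) szP.
apply/eqP; rewrite eqn_leq szle /=.
apply: contraT; rewrite -leqNgt => szk.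
suff: 0 < (col_per_line a k w u)`_k by rewrite nth_default ?ltxx.
rewrite /col_per_line /col_per coef_sum.
have pos s : 0 < (\prod_(j < n) F s j)`_k.
  have := @lead_coef_prod _ _ (index_enum _) xpredT (F s).
  rewrite /lead_coef szP /= => ->.
  by apply: prodr_gt0 => j _; exact: ldF.
rewrite (bigD1 1%g) //=; apply: ltr_pwDl; first exact: pos.
by apply: sumr_ge0 => s _; exact/ltW/pos.
Qed.

Lemma col_per_full (C : comNzRingType) (n : nat) (a : 'I_n -> 'I_n -> C) w :
  col_per a n w = n`!%:R * \prod_i w i.
Proof.
transitivity (\sum_(s : 'S_n) \prod_i w i).
  apply: eq_bigr => s _; rewrite [RHS](reindex_inj (@perm_inj _ s)) /=.
  by apply: eq_bigr => j _; rewrite ltn_ord.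
by rewrite sumr_const card_Sn mulr_natl.
Qed.

Lemma col_per_gt0 (C : numDomainType) (n : nat) (a : 'I_n -> 'I_n -> C) k w :
  (forall i j, 0 < a i j) -> (forall i, 0 < w i) -> 0 < col_per a k w.
Proof.
move=> a0 w0; have pos (s : 'S_n) :
    0 < \prod_(j < n) (if (j < k)%N then w (s j) else a (s j) j).
  by apply: prodr_gt0 => j _; case: ifP.
rewrite /col_per (bigD1 1%g) //=; apply: ltr_pwDl; first exact: pos.
by apply: sumr_ge0 => s _; exact/ltW/pos.
Qed.

(* The roots of [col_per_line a k.+1 z (a^~ k)] lie in the open lower half
   plane, so the sum of their inverses, hence the coefficient of ['X], is
   nonzero. *)
Lemma col_per_stable (C : numClosedFieldType) (n : nat)
    (a : 'I_n -> 'I_n -> C) (k : nat) z :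
  (k <= n)%N -> (forall i j, 0 < a i j) -> (forall i, 0 < 'Im (z i)) ->
  col_per a k z != 0.
Proof.
(* Downward induction from [k = n], where [col_per_full] leaves a product of nonzero factors. *)
move=> kn a0; move: z; rewrite -(subKn kn).
elim: (n - k)%N => [|m IH] z z0.
  rewrite subn0 col_per_full mulf_neq0 ?pnatr_eq0 -?lt0n ?fact_gt0 //.
  apply/prodf_neq0 => i _; apply: contraTneq (z0 i) => ->.
  by rewrite raddf0 ltxx.
(* Truncated subtraction: once [m] reaches [n] the index stays at 0. *)
case: (leqP n m) => [nm|mn].
  by have -> : (n - m.+1 = n - m)%N; [lia | exact: IH].
have E : (n - m = (n - m.+1).+1)%N by rewrite subnSK.
have ltk : (n - m.+1 < n)%N by lia.
pose k' := Ordinal ltk.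
pose p := col_per_line a k'.+1 z (a^~ k').
have pE := coef1_col_per_line a k' z.
have szp : size p = k'.+2 by rewrite size_col_per_line.
have p0 : p`_0 != 0 by rewrite coef0_col_per_line -E; exact: IH.
have [r [szr rootr p1 _]] := poly_factor_at0 p0.
suff : p`_1 != 0.
  by rewrite pE; apply: contraNneq; rewrite /= => ->; rewrite mul0rn.
rewrite p1 mulf_neq0 ?oppr_eq0 //.
(* If [t] had nonnegative imaginary part, adding [t] times a positive column would keep the point in
   the upper half plane, where the induction hypothesis excludes zeros. *)
have Imr t : t \in r -> 'Im t < 0.
  move=> /rootr; rewrite rootE horner_col_per_line => Pt.
  rewrite real_ltNge ?Creal_Im ?real0 //; apply/negP => t0.
  suff /negP : col_per a (n - m) (fun i => z i + t * a i k') != 0 by rewrite E.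
  apply: IH.
  move=> i; rewrite raddfD /= ImMr ?gtr0_real //.
  by rewrite ltr_pwDl // mulr_ge0 // ltW.
suff : 0 < 'Im (\sum_(t <- r) t^-1).
  by apply: contraTneq => ->; rewrite raddf0 ltxx.
rewrite raddf_sum /= big_seq.
have rs : (0 < size r)%N by rewrite szr szp.
case: r Imr rs {szr rootr p1} => // t r Imr _.
have pos y : y \in t :: r -> 0 < 'Im y^-1.
  move=> yr; rewrite ImV divr_gt0 ?oppr_gt0 ?Imr // exprn_gt0 // normr_gt0.
  by apply: contraTneq (Imr _ yr) => ->; rewrite raddf0 ltxx.
rewrite -big_seq big_cons; apply: ltr_pwDl; first by rewrite pos ?mem_head.
by rewrite big_seq sumr_ge0 // => y yr; rewrite ltW // pos // inE yr orbT.
Qed.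

Lemma conjC_col_per (C : numClosedFieldType) (n : nat)
    (a : 'I_n -> 'I_n -> C) (k : nat) z :
  (forall i j, 0 < a i j) ->
  (col_per a k z)^* = col_per a k (fun i => (z i)^*).
Proof.
move=> a0; rewrite rmorph_sum; apply: eq_bigr => s _.
rewrite rmorph_prod; apply: eq_bigr => j _; case: ifP => // _.
by apply/CrealP; rewrite gtr0_real.
Qed.

(** Stability excludes roots in the open upper half plane. The polynomial has real coefficients, so
    the conjugate of a root is a root and every root is real. At a nonnegative [t] all entries are
    positive and so is the value. *)
Lemma col_per_line_root (C : numClosedFieldType) (n : nat)
    (a : 'I_n -> 'I_n -> C) (k : nat) (w u : 'I_n -> C) t :
  (k <= n)%N -> (forall i j, 0 < a i j) -> (forall i, 0 < w i) ->
  (forall i, 0 < u i) -> root (col_per_line a k w u) t -> t < 0.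
Proof.
move=> kn a0 w0 u0; rewrite rootE horner_col_per_line => Pt.
have Imle y : col_per a k (fun i => w i + y * u i) == 0 -> 'Im y <= 0.
  move=> Py; rewrite real_leNgt ?Creal_Im ?real0 //; apply/negP => y0.
  suff /negP : col_per a k (fun i => w i + y * u i) != 0 by [].
  apply: col_per_stable => // i; rewrite raddfD /= ImMr ?gtr0_real //.
  by rewrite (Creal_ImP _ (gtr0_real (w0 i))) add0r mulr_gt0.
have treal : t \is Num.real.
  apply/Creal_ImP/eqP; rewrite eq_le Imle //=.
  have : 'Im t^* <= 0; last by rewrite Im_conj oppr_le0.
  apply: Imle; rewrite -(conjC0 C) -(eqP Pt) conjC_col_per //.
  apply/eqP; apply: eq_col_per => i; rewrite rmorphD rmorphM /=.
  by rewrite (CrealP (gtr0_real (w0 i))) (CrealP (gtr0_real (u0 i))).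
rewrite real_ltNge ?real0 //; apply/negP => t0.
move: Pt; rewrite gt_eqF // col_per_gt0 // => i.
by rewrite ltr_pwDl // mulr_ge0 // ltW.
Qed.

(** * The capacity bound for permanents *)

Lemma prod_seq_AGM (F : numFieldType) (I : eqType) (r : seq I) (E : I -> F) :
  {in r, forall i, 0 <= E i} ->
  \prod_(i <- r) E i <= ((\sum_(i <- r) E i) / (size r)%:R) ^+ size r.
Proof.
move=> E0; rewrite (big_tnth _ _ r) (big_tnth _ _ r).
have := @leif_AGM F 'I_(size r) predT (fun i => E (tnth (in_tuple r) i)).
rewrite cardT size_enum_ord => H; apply: H => i _; apply: E0.
exact: mem_tnth.
Qed.

(** One step of Gurvits' argument. The restriction [p] to the line in direction [a^~ k] has only
    negative roots, so p(t)/p(0) is a product of positive factors 1 - t/z. AM-GM bounds it through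
    the sum of the 1/z, that is, through the derivative of [p] at 0. *)
Lemma col_per_step (C : numClosedFieldType) (n : nat)
    (a : 'I_n -> 'I_n -> C) (k : 'I_n) w :
  (forall i j, 0 < a i j) -> (forall i, 0 < w i) ->
  exists2 t, 0 < t &
    col_per a k.+1 (fun i => w i + t * a i k) * k.+1%:R ^+ k <=
    t * (col_per a k w * k.+2%:R ^+ k.+1).
Proof.
move=> a0 w0; pose p := col_per_line a k.+1 w (a^~ k).
have p0 : 0 < p`_0 by rewrite coef0_col_per_line col_per_gt0.
have pE : p`_1 = col_per a k w *+ k.+1 := coef1_col_per_line a k w.
have p1 : 0 < p`_1 by rewrite pE pmulrn_lgt0 // col_per_gt0.
have [r [szr rootr p1E hp]] := poly_factor_at0 (lt0r_neq0 p0).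
have sr : size r = k.+1 by rewrite szr size_col_per_line.
(* Here -t times the sum of the 1/z is 1, so the factors 1 - t/z have mean (k+2)/(k+1). The
   minimiser of the AM-GM bound divided by t is (k+1)/k times larger and does not exist for
   [k = 0]. *)
exists (p`_0 / p`_1); first by rewrite divr_gt0.
rewrite -(horner_col_per_line a k.+1 w (a^~ k)) -/p.
set t := p`_0 / p`_1; have t0 : 0 < t by rewrite divr_gt0.
have rneg z : z \in r -> z < 0.
  by move=> /rootr; apply: col_per_line_root.
have le : p.[t] <= p`_0 * (k.+2%:R / k.+1%:R) ^+ k.+1.
  rewrite hp ler_pM2l //; apply: le_trans (prod_seq_AGM _) _.
    move=> z /rneg z0 /=; rewrite subr_ge0 (le_trans (y := 0)) //.
    by rewrite ltW // pmulr_rlt0 // invr_lt0.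
  rewrite sr.
  suff -> : \sum_(z <- r) (1 - t / z) = k.+2%:R by [].
  have -> : \sum_(z <- r) (1 - t / z) = k.+1%:R - t * \sum_(z <- r) z^-1.
    by rewrite big_split /= sumrN -mulr_sumr big_const_seq count_predT sr iter_addr_0.
  have -> : t * \sum_(z <- r) z^-1 = -1.
    rewrite /t mulrAC; apply: (canLR (mulfK (lt0r_neq0 p1))).
    by rewrite p1E; ring.
  by rewrite opprK -mulrSr.
have tp : p`_0 = t * (col_per a k w * k.+1%:R).
  by rewrite mulr_natr -pE /t mulfVK // gt_eqF.
apply: le_trans (ler_wpM2r _ le) _; first by rewrite exprn_ge0 ?ler0n.
have d0 : k.+1%:R != 0 :> C by rewrite pnatr_eq0.
rewrite tp expr_div_n [X in _ / X]exprS.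
move: (k.+2%:R ^+ k.+1) (expf_neq0 k d0) => c; move: (k.+1%:R ^+ k) d0 => b.
move: (k.+1%:R : C) => d d0 b0.
by rewrite le_eqVlt; apply/orP; left; apply/eqP; field; rewrite b0 d0.
Qed.

(** [M] is a lower bound for the capacity of the product of the linear forms. Going down from
    [k = n], the variable of column [k] is set to the [t] of [col_per_step]. The costs of the steps
    telescope, which explains the factors (k+1)^k and (n+1)^n. *)
Lemma col_per_capacity (C : numClosedFieldType) (n : nat)
    (a : 'I_n -> 'I_n -> C) (M : C) (k : nat) (x : 'I_n -> C) :
  0 <= M -> (forall i j, 0 < a i j) ->
  (forall y : 'I_n -> C, (forall j, 0 < y j) ->
     M * \prod_j y j <= \prod_i \sum_j y j * a i j) ->
  (k <= n)%N -> (forall j, 0 < x j) ->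
  k.+1%:R ^+ k * n`!%:R * M * \prod_(j < n | (j < k)%N) x j <=
  col_per a k (fun i => \sum_(j < n | (j < k)%N) x j * a i j) * n.+1%:R ^+ n.
Proof.
move=> M0 a0 cap kn; move: x; rewrite -(subKn kn).
have := leq_subr k n; move: (n - k)%N => m {k kn}.
elim: m => [|m IH] mn x x0.
  rewrite subn0 (eq_bigl xpredT) => [|j]; last by rewrite ltn_ord.
  have c0 : 0 <= n.+1%:R ^+ n * n`!%:R :> C.
    by rewrite mulr_ge0 ?exprn_ge0 ?ler0n.
  rewrite col_per_full -mulrA [leRHS]mulrC [leRHS]mulrA.
  apply: ler_wpM2l => //; apply: le_trans (cap x x0) _.
  rewrite le_eqVlt; apply/orP; left; apply/eqP; apply: eq_bigr => i _.
  by apply: eq_bigl => j; rewrite ltn_ord.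
have E : (n - m = (n - m.+1).+1)%N by rewrite subnSK.
have ltk : (n - m.+1 < n)%N by lia.
move: (IH (ltnW mn)) ltk; rewrite {}E {IH}.
move: (n - m.+1)%N => k IH ltk; pose k' := Ordinal ltk.
have splitk (F : 'I_n -> C) : \sum_(j < n | (j < k.+1)%N) F j =
    \sum_(j < n | (j < k)%N) F j + F k'.
  rewrite (bigD1 k') ?ltnS //= addrC; congr (_ + _); apply: eq_bigl => j.
  by rewrite -val_eqE /= ltnS [RHS]ltn_neqAle andbC.
have splitk' (F : 'I_n -> C) : \prod_(j < n | (j < k.+1)%N) F j =
    (\prod_(j < n | (j < k)%N) F j) * F k'.
  rewrite (bigD1 k') ?ltnS //= mulrC; congr (_ * _); apply: eq_bigl => j.
  by rewrite -val_eqE /= ltnS [RHS]ltn_neqAle andbC.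
pose x' t j := if j == k' then t else x j.
have x'0 t : 0 < t -> forall j, 0 < x' t j by move=> t0 j; rewrite /x'; case: ifP.
have sumx' t i : \sum_(j < n | (j < k.+1)%N) x' t j * a i j =
    \sum_(j < n | (j < k)%N) x j * a i j + t * a i k'.
  rewrite splitk {2}/x' eqxx; congr (_ + _); apply: eq_bigr => j jk.
  by rewrite /x' -val_eqE /= (ltn_eqF jk).
have prodx' t : \prod_(j < n | (j < k.+1)%N) x' t j =
    (\prod_(j < n | (j < k)%N) x j) * t.
  rewrite splitk' {2}/x' eqxx; congr (_ * _); apply: eq_bigr => j jk.
  by rewrite /x' -val_eqE /= (ltn_eqF jk).
have {}IH t : 0 < t -> k.+2%:R ^+ k.+1 * n`!%:R * M *
      ((\prod_(j < n | (j < k)%N) x j) * t) <=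
    col_per a k.+1 (fun i => \sum_(j < n | (j < k)%N) x j * a i j + t * a i k')
      * n.+1%:R ^+ n.
  move=> /x'0 t0; have := IH _ t0; rewrite prodx'.
  by rewrite (eq_col_per _ _ (sumx' t)).
have c0 : 0 < \prod_(j < n | (j < k)%N) x j by rewrite prodr_gt0.
case: (posnP k) => [k0|k0]; last first.
  have w0 i : 0 < \sum_(j < n | (j < k)%N) x j * a i j.
    rewrite (bigD1 (Ordinal (leq_ltn_trans (leq0n k) ltk))) //=.
    apply: ltr_pwDl; first by rewrite mulr_gt0.
    by rewrite sumr_ge0 // => j _; rewrite ltW // mulr_gt0.
  have [t t0 /=] := col_per_step k' a0 w0.
  set P1 := col_per a k.+1 _; set P0 := col_per a k _ => H.
  have {IH} := IH t t0; rewrite -/P1 => IH.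
  have d0 : 0 < t * k.+2%:R ^+ k.+1 by rewrite mulr_gt0 // exprn_gt0 ?ltr0n.
  rewrite -(ler_pM2l d0).
  have e0 : 0 <= k.+1%:R ^+ k :> C by rewrite exprn_ge0 ?ler0n.
  have f0 : 0 <= n.+1%:R ^+ n :> C by rewrite exprn_ge0 ?ler0n.
  have := ler_wpM2l e0 IH; have := ler_wpM2r f0 H.
  move=> H1 H2.
  set L := leLHS; have -> : L = k.+1%:R ^+ k * (k.+2%:R ^+ k.+1 * n`!%:R * M *
      ((\prod_(j < n | (j < k)%N) x j) * t)) by rewrite /L; ring.
  apply: le_trans H2 _; rewrite mulrA [_ * P1]mulrC; apply: le_trans H1 _.
  by rewrite le_eqVlt; apply/orP; left; apply/eqP; rewrite /=; ring.
(* At [k = 0] the point is the empty sum 0, so [col_per_step] does not apply. With t = 1, column 0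
   is replaced by itself and both sides are permanents; a factor 2 is given away. *)
subst k; have := IH 1 ltr01.
rewrite !big_pred0 // expr1 expr0 !mul1r mulr1 => H.
apply: le_trans (le_trans H _).
  by rewrite mulr1 -!mulrA [leRHS]mulrC ler_peMr ?mulr_ge0 ?ler0n ?ler1n.
rewrite ler_wpM2r ?exprn_ge0 ?ler0n // le_eqVlt; apply/orP; left; apply/eqP.
apply: eq_bigr => s _; apply: eq_bigr => j _; rewrite /= ltnS leqn0.
case: eqP => //= j0; have -> : j = k' by apply: val_inj.
by rewrite big_pred0 // add0r mul1r.
Qed.

(** AM-GM in each row, on the [r] numbers obtained by listing [x j] with multiplicity [A i j]. In
    the product over the rows each [x j] gets its column sum [r] as exponent. So the capacity is at
    least r^n. *)
Lemma regular_AGM (F : numFieldType) (n r : nat) (A : 'I_n -> 'I_n -> nat)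
    (x : 'I_n -> F) :
  (0 < r)%N -> (forall i, \sum_j A i j = r)%N -> (forall j, \sum_i A i j = r)%N ->
  (forall j, 0 < x j) ->
  r%:R ^+ n * \prod_j x j <= \prod_i \sum_j x j * (A i j)%:R.
Proof.
move=> r0 Arow Acol x0; have r0' : 0 < r%:R :> F by rewrite ltr0n.
pose S i := \sum_j x j * (A i j)%:R.
have row_AGM i : \prod_j x j ^+ A i j <= (S i / r%:R) ^+ r.
  pose l := flatten [seq nseq (A i j) (x j) | j <- index_enum 'I_n].
  have szl : size l = r.
    rewrite size_flatten sumnE big_map big_map -(Arow i).
    by apply: eq_bigr => j _; rewrite size_nseq.
  have := @prod_seq_AGM F _ l id; rewrite szl !big_flatten !big_map /=.
  have -> : \sum_j \sum_(y <- nseq (A i j) (x j)) y = S i.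
    apply: eq_bigr => j _.
    by rewrite big_nseq iter_addr_0 mulr_natr.
  have -> : \prod_j \prod_(y <- nseq (A i j) (x j)) y =
      \prod_j x j ^+ A i j.
    by apply: eq_bigr => j _; rewrite big_nseq iter_mulr_1.
  apply=> y /flatten_mapP[j _ /nseqP[-> _]]; exact: ltW.
have S0 i : 0 <= S i by rewrite sumr_ge0 // => j _; rewrite mulr_ge0 ?ler0n // ltW.
suff : \prod_j x j <= \prod_i (S i / r%:R).
  by rewrite big_split /= prodr_const card_ord exprVn ler_pdivlMr ?exprn_gt0 // mulrC.
rewrite -(@ler_pXn2r _ r) ?nnegrE ?prodr_ge0 // => [|j _|i _]; last first.
- by rewrite divr_ge0 // ltW.
- exact: ltW.
rewrite -!prodrXl; apply: le_trans (_ : \prod_i \prod_j x j ^+ A i j <= _).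
  rewrite exchange_big /= le_eqVlt; apply/orP; left; apply/eqP.
  by apply: eq_bigr => j _; rewrite prodrXr Acol.
apply: ler_prod => i _; rewrite row_AGM andbT.
by apply: prodr_ge0 => j _; rewrite exprn_ge0 // ltW.
Qed.

Lemma per_ge_pos_regular (n r : nat) (A : 'I_n -> 'I_n -> nat) :
  (forall i j, 0 < A i j)%N ->
  (forall i, \sum_j A i j = r)%N -> (forall j, \sum_i A i j = r)%N ->
  (r ^ n * n`! <= (\sum_(s : 'S_n) \prod_j A (s j) j) * n.+1 ^ n)%N.
Proof.
move=> A0 Arow Acol; case: n A A0 Arow Acol => [|n] A A0 Arow Acol.
  rewrite (bigD1 1%g) //= big_ord0.
  by rewrite !expn0 fact0 !muln1 leq_addr.
have r0 : (0 < r)%N.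
  by rewrite -(Arow ord0) (bigD1 ord0) //= (leq_trans (A0 ord0 ord0)) // leq_addr.
have H : r%:R ^+ n.+1 * n.+1`!%:R <= col_per (fun i j => (A i j)%:R)
    0 (fun i => \sum_(j < n.+1 | (j < 0)%N) 1 * (A i j)%:R) * n.+2%:R ^+ n.+1 :> algC.
  apply: le_trans (@col_per_capacity _ _ _ (r%:R ^+ n.+1) 0 (fun=> 1) _ _ _ _ _).
  - by rewrite expr0 mul1r big_pred0 // mulr1 mulrC.
  - by rewrite exprn_ge0 ?ler0n.
  - by move=> i j; rewrite ltr0n.
  - by move=> y y0; apply: regular_AGM.
  - by [].
  - by move=> j; exact: ltr01.
have E w : col_per (fun i j => (A i j)%:R) 0 w =
    (\sum_(s : 'S_n.+1) \prod_j A (s j) j)%:R :> algC.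
  by rewrite natr_sum; apply: eq_bigr => s _; rewrite natr_prod.
by move: H; rewrite E -!natrX -!natrM ler_nat.
Qed.

(* A regular graph is reached as the limit of the positive matrices
   [N A + J], [J] being the all-ones matrix. *)
Lemma perfect_matchings_ge (n r : nat) (G : rel 'I_n) :
  (forall i, #|[pred j | G i j]| = r) -> (forall j, #|[pred i | G i j]| = r) ->
  (r ^ n * n`! <= #|[set s : 'S_n | [forall j, G (s j) j]]| * n.+1 ^ n)%N.
Proof.
move=> Grow Gcol; case: (posnP n) => [n0|n0].
  subst n; rewrite !expn0 fact0 mul1n muln1 card_gt0; apply/set0Pn; exists 1%g.
  by rewrite inE; apply/forallP => -[].
have rn : (r <= n)%N by rewrite -(Grow (Ordinal n0)) -[leqRHS]card_ord max_card.
pose S := [set s : 'S_n | [forall j, G (s j) j]].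
rewrite -/S leqNgt; apply/negP => lt.
(* No limit is taken: a failing inequality between integers fails by at least 1. A permutation
   outside [S] meets a non-edge, where [A] is 1. Such permutations add at most n! (N+1)^(n-1), and
   after multiplication by (n+1)^n this is N (N+1)^(n-1), less than the gap (N+1)^n. *)
pose N := (n`! * n.+1 ^ n)%N.
pose A i j := (N * G i j + 1)%N.
have sumG (P : pred 'I_n) : (\sum_j (N * P j + 1) = N * #|[pred j | P j]| + n)%N.
  rewrite big_split /= sum1_card card_ord -big_distrr /= -sum1_card.
  by rewrite [in RHS]big_mkcond.
have := @per_ge_pos_regular n (N * r + n) A.
have perA : (\sum_(s : 'S_n) \prod_j A (s j) j <=
    #|S| * N.+1 ^ n + n`! * N.+1 ^ n.-1)%N.
  have -> : (#|S| * N.+1 ^ n = \sum_(s in S) N.+1 ^ n)%N by rewrite sum_nat_const.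
  have -> : (n`! * N.+1 ^ n.-1 = \sum_(s : 'S_n) N.+1 ^ n.-1)%N.
    by rewrite sum_nat_const card_Sn.
  rewrite [X in (_ <= X + _)%N]big_mkcond -big_split /=; apply: leq_sum => s _.
  have leA i j : (A i j <= N.+1)%N by rewrite /A; case: (G i j); rewrite ?muln0 ?muln1 addn1.
  case: ifPn => [_|sS].
    apply: leq_trans (leq_addr _ _); rewrite -[X in (_ <= _ ^ X)%N]card_ord -prod_nat_const.
    by apply: leq_prod => j _.
  move: sS; rewrite inE negb_forall => /existsP[j nG].
  rewrite (bigD1 j) //= {1}/A (negPf nG) muln0 add0n mul1n.
  have -> : (n.-1 = #|[pred i | i != j]|)%N.
    by have := cardC1 j; rewrite card_ord => <-; apply: eq_card => i; rewrite !inE.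
  by rewrite -prod_nat_const; apply: leq_prod => i _.
have Arow i : (\sum_j A i j = N * r + n)%N by rewrite /A sumG Grow.
have Acol j : (\sum_i A i j = N * r + n)%N.
  by rewrite /A (sumG (fun i => G i j)) Gcol.
have A0 i j : (0 < A i j)%N by rewrite /A addn1.
have H := per_ge_pos_regular A0 Arow Acol.
have : (r ^ n * n`! * N.+1 ^ n <=
    (#|S| * N.+1 ^ n + n`! * N.+1 ^ n.-1) * n.+1 ^ n)%N.
  apply: leq_trans (leq_trans H _); last by rewrite leq_mul2r perA orbT.
  rewrite mulnAC -expnMn leq_mul2r leq_exp2r //; apply/orP; right; nia.
have -> : (N.+1 ^ n = N.+1 * N.+1 ^ n.-1)%N by rewrite -expnS prednK.
have : (0 < N.+1 ^ n.-1)%N by rewrite expn_gt0.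
move: (N.+1 ^ n.-1)%N => c c0; move: lt; rewrite -/S.
move: (r ^ n * n`!)%N => K lt; rewrite leqNgt => /negP[].
rewrite mulnDl [(n`! * c * _)%N]mulnAC -/N.
apply: (@leq_trans ((#|S| * n.+1 ^ n + 1) * (N.+1 * c))); nia.
Qed.

(** * Bregman's inequality *)

(* Equal to [0] at [r = 0]. *)
Definition ln_fact_root (R : realType) (r : nat) : R := ln (r`!%:R) / r%:R.

(** A partial matching is encoded as a full permutation [s0] together with the set [F] on which it
    counts. This lets any extension [s] serve as the next partial matching on [i |: F]. *)
Definition perms_extending (n : nat) (G : rel 'I_n) (F : {set 'I_n})
    (s0 : 'S_n) : {set 'S_n} :=
  [set s : 'S_n | [forall j, if j \in F then s j == s0 j else G j (s j)]].

Definition free_nbrs (n : nat) (G : rel 'I_n) (F : {set 'I_n}) (s0 : 'S_n)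
    (j : 'I_n) : {set 'I_n} :=
  [set k | G j k & k \notin [set s0 i | i in F]].

Lemma perms_extendingP n (G : rel 'I_n) (F : {set 'I_n}) (s0 : 'S_n) (s : 'S_n) :
  reflect ((forall j, j \in F -> s j = s0 j) /\ (forall j, j \notin F -> G j (s j)))
    (s \in perms_extending G F s0).
Proof.
rewrite inE; apply: (iffP forallP) => [H|[H1 H2] j].
  by split=> j jF; move: (H j); rewrite ?jF ?(negPf jF) // => /eqP.
by case: ifPn => [/H1 ->|/H2].
Qed.

Lemma perms_extending_setU1 n (G : rel 'I_n) (F : {set 'I_n}) (s0 : 'S_n) (s : 'S_n) i :
  i \notin F -> s \in perms_extending G F s0 ->
  perms_extending G (i |: F) s = [set s' in perms_extending G F s0 | s' i == s i].
Proof.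
move=> iF /perms_extendingP[sF sG]; apply/setP => s'; rewrite [RHS]inE.
apply/perms_extendingP/andP => [[H1 H2]|[/perms_extendingP[H1 H2] /eqP H3]].
  have s'i : s' i = s i by rewrite H1 ?setU11.
  split; last exact/eqP.
  apply/perms_extendingP; split=> j jF.
    by rewrite H1 ?sF // in_setU1 jF orbT.
  have [->|ji] := eqVneq j i; first by rewrite s'i sG.
  by apply: H2; rewrite in_setU1 negb_or ji.
split=> j; rewrite in_setU1; first by case/predU1P=> [->//|jF]; rewrite H1 ?sF.
by rewrite negb_or => /andP[_]; apply: H2.
Qed.

Lemma perms_extending_free n (G : rel 'I_n) (F : {set 'I_n}) (s0 : 'S_n) (s : 'S_n) i :
  i \notin F -> s \in perms_extending G F s0 -> s i \in free_nbrs G F s0 i.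
Proof.
move=> iF /perms_extendingP[sF sG]; rewrite inE sG //=.
by apply/imsetP => -[j jF]; rewrite -sF // => /perm_inj ij; rewrite ij jF in iF.
Qed.

Lemma card_free_nbrs_setU1 n (G : rel 'I_n) (F : {set 'I_n}) (s0 : 'S_n) (s : 'S_n) i j :
  i \notin F -> s \in perms_extending G F s0 ->
  #|free_nbrs G (i |: F) s j| = (#|free_nbrs G F s0 j| - G j (s i))%N.
Proof.
move=> iF sS; have [sF sG] := perms_extendingP _ _ _ _ sS.
have := perms_extending_free iF sS; rewrite inE => /andP[_ siF].
have -> : free_nbrs G (i |: F) s j = free_nbrs G F s0 j :\ s i.
  apply/setP => k; rewrite !inE imsetU1 in_setU1 negb_or.
  rewrite (eq_in_imset (g := s0)) => [|x xF]; last exact: sF.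
  by case: (G j k); rewrite ?andbF.
rewrite (cardsD1 (s i) (free_nbrs G F s0 j)) inE siF andbT.
by rewrite addKn.
Qed.

(** Any extension [s] maps the complement of [F] bijectively onto the values still free. So the
    number of rows whose value is a neighbour of [j] is the same for every [s], which is what makes
    the averaging in [bregman_extending] exact. *)
Lemma card_perms_extending_neighbours n (G : rel 'I_n) (F : {set 'I_n}) (s0 : 'S_n) (s : 'S_n) j :
  j \notin F -> s \in perms_extending G F s0 ->
  #|[set i | i \notin F & G j (s i)]| = #|free_nbrs G F s0 j|.
Proof.
move=> jF sS; have [sF _] := perms_extendingP _ _ _ _ sS.
rewrite -(card_imset _ (@perm_inj _ s)); apply: eq_card => k.
rewrite inE; apply/imsetP/andP => [[i]|[Gjk kF]].
  rewrite inE => /andP[iF Gi] ->; split=> //.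
  by apply/imsetP => -[x xF]; rewrite -sF // => /perm_inj ix; rewrite ix xF in iF.
exists (s^-1 k)%g; last by rewrite permKV.
rewrite inE permKV Gjk andbT; apply: contra kF => kF.
by apply/imsetP; exists (s^-1 k)%g => //; rewrite -sF // permKV.
Qed.

(* Picking a uniform element [s], the value [s i] has entropy at most the
   logarithm of the number of its possible values. *)
Lemma entropy_row (R : realType) n (G : rel 'I_n) (F : {set 'I_n}) (s0 : 'S_n) i :
  i \notin F ->
  #|perms_extending G F s0|%:R * ln (#|perms_extending G F s0|%:R : R) <=
  #|perms_extending G F s0|%:R * ln (#|free_nbrs G F s0 i|%:R : R) +
  \sum_(s in perms_extending G F s0) ln (#|perms_extending G (i |: F) s|%:R : R).
Proof.
move=> iF; set S := perms_extending G F s0; set D := free_nbrs G F s0 i.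
have [->|[s1 s1S]] := set_0Vmem S; first by rewrite cards0 !mul0r big_set0 addr0.
pose T : R := #|S|%:R; pose d : R := #|D|%:R.
pose t (s : 'S_n) : R := #|perms_extending G (i |: F) s|%:R.
have T0 : 0 < T by rewrite ltr0n; apply/card_gt0P; exists s1.
have d0 : 0 < d.
  by rewrite ltr0n; apply/card_gt0P; exists (s1 i); apply: perms_extending_free.
have t0 s : s \in S -> 0 < t s.
  move=> sS; rewrite ltr0n; apply/card_gt0P; exists s.
  by rewrite (perms_extending_setU1 iF sS) inE sS eqxx.
(* Grouped by the value of [s i], a nonempty class of size c contributes c times 1/c, and there are
   at most [d] classes. *)
have sum_inv : \sum_(s in S) (t s)^-1 <= d.
  rewrite (partition_big (fun s : 'S_n => s i) (mem D)) /=; last first.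
    by move=> s sS; apply: perms_extending_free.
  rewrite /d -sum1_card natr_sum; apply: ler_sum => k _.
  pose Sk := [set s in S | s i == k].
  rewrite (eq_bigr (fun=> #|Sk|%:R^-1)) => [|s /andP[sS /eqP sk]]; last first.
    by rewrite /t (perms_extending_setU1 iF sS) sk.
  rewrite sumr_const.
  have -> : #|(fun s : 'S_n => (s \in S) && (s i == k))| = #|Sk|.
    by apply: eq_card => s; rewrite [RHS]inE.
  rewrite -[X in X <= _]mulr_natr.
  case: (posnP #|Sk|) => [->|Sk0]; first by rewrite mulr0.
  by rewrite mulVf // pnatr_eq0 -lt0n.
have sumS (c : R) : \sum_(s in S) c = T * c by rewrite sumr_const mulr_natl.
suff : \sum_(s in S) (ln T - ln d - ln (t s)) <= 0.
  rewrite !big_split /= !sumrN !sumS -/T.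
  by rewrite subr_le0 lerBlDl.
apply: le_trans (_ : \sum_(s in S) (T / d * (t s)^-1 - 1) <= _).
  apply: ler_sum => s sS; rewrite -ln_div ?posrE // -ln_div ?posrE ?divr_gt0 ?t0 //.
  set x := T / d / t s; have x0 : 0 < x by rewrite !divr_gt0 ?t0.
  by have := @le_ln1Dx R (x - 1); rewrite addrCA subrr addr0; apply; lra.
rewrite big_split /= -mulr_sumr sumS mulrN1 subr_le0.
by rewrite mulrAC ler_pdivrMr // ler_pM2l.
Qed.

(** [entropy_row] is summed over all M rows [i] outside [F], in place of a random order of the rows.
    For fixed [s] and [j] of degree d, the choice i = j gives ln d, d - 1 other rows lower the
    degree of [j] to d - 1, and M - d rows leave it. Then ln d + ln (d-1)! + (M-d) ln(d!)/d = M
    ln(d!)/d. *)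
Lemma bregman_extending (R : realType) n (G : rel 'I_n) (F : {set 'I_n}) (s0 : 'S_n) :
  (0 < #|perms_extending G F s0|)%N ->
  ln (#|perms_extending G F s0|%:R : R) <=
  \sum_(j | j \notin F) ln_fact_root R #|free_nbrs G F s0 j|.
Proof.
have [m] := ubnP #|~: F|; elim: m => // m IH in F s0 *; rewrite ltnS => Fm S0.
set S := perms_extending G F s0.
pose d j := #|free_nbrs G F s0 j|.
have [F0|[i0 i0F]] := set_0Vmem (~: F).
  have SE : #|S| = 1%N.
    apply/eqP; rewrite eqn_leq S0 andbT; apply/card_le1P => s sS s'.
    have FT j : j \in F by move/setP/(_ j): F0; rewrite !inE => /negbFE.
    have [sF _] := perms_extendingP _ _ _ _ sS.
    rewrite [RHS]inE; apply/idP/eqP => [/perms_extendingP[s'F _]|->//].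
    by apply/permP => j; rewrite sF ?s'F.
  rewrite SE ln1 big_pred0 // => j.
  by move/setP/(_ j): F0; rewrite !inE.
pose M : R := #|~: F|%:R.
have M0 : 0 < M by rewrite ltr0n; apply/card_gt0P; exists i0.
have T0 : 0 < (#|S|%:R : R) by rewrite ltr0n.
have sumF (c : R) : \sum_(i | i \notin F) c = M * c.
  rewrite sumr_const /M mulr_natl; congr (_ *+ _).
  by apply: eq_card => j; rewrite inE.
rewrite -(ler_pM2l T0) -(ler_pM2l M0) -sumF.
apply: le_trans (ler_sum _ (fun i iF => entropy_row R G s0 iF)) _.
rewrite -/S big_split /= -mulr_sumr exchange_big /=.
have inner s : s \in S ->
    \sum_(i | i \notin F) ln (#|perms_extending G (i |: F) s|%:R : R) <=
    \sum_(j | j \notin F) (ln ((d j).-1`!%:R : R) +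
       (#|~: F| - d j)%N%:R * ln_fact_root R (d j)).
  move=> sS.
  apply: le_trans (_ : \sum_(i | i \notin F) \sum_(j | j \notin i |: F)
     ln_fact_root R (d j - G j (s i))%N <= _).
    apply: ler_sum => i iF.
    have sSi : s \in perms_extending G (i |: F) s.
      by rewrite (perms_extending_setU1 iF sS) inE sS eqxx.
    apply: le_trans (IH (i |: F) s _ _) _.
    - apply: leq_trans Fm; apply: proper_card; rewrite properC.
      apply/properP; split; first exact: subsetUr.
      by exists i; rewrite ?setU11.
    - by apply/card_gt0P; exists s.
    by apply: ler_sum => j _; rewrite (card_free_nbrs_setU1 _ iF sS).
  rewrite (exchange_big_dep (fun j => j \notin F)) /=; last first.
    by move=> i j _; rewrite in_setU1 negb_or => /andP[].
  apply: ler_sum => j jF; rewrite (bigID (fun i => G j (s i))) /=.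
  pose A := [set i | i \notin F & G j (s i)].
  have cA : #|A| = d j := card_perms_extending_neighbours jF sS.
  have jA : j \in A.
    by have [_ sG] := perms_extendingP _ _ _ _ sS; rewrite inE jF sG.
  apply: lerD.
    rewrite (eq_bigr (fun=> ln_fact_root R (d j).-1)) => [|i /andP[_ ->]]; last first.
      by rewrite subn1.
    rewrite sumr_const -[X in X <= _]mulr_natl.
    have -> : #|(fun i => (i \notin F) && (j \notin i |: F) && G j (s i))| = (d j).-1.
      rewrite -cA (cardsD1 j) jA /=; apply: eq_card => i.
      rewrite [LHS]unfold_in in_setU1 negb_or jF andbT !inE eq_sym.
      by case: (i \notin F); rewrite ?andbF.
    (* For degree 1 there are no such rows, and ln 0! = 0 agrees. *)
    rewrite /ln_fact_root; case: ((d j).-1) => [|e]; first by rewrite mul0r ln1.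
    by rewrite mulrC mulfVK // pnatr_eq0.
  rewrite (eq_bigr (fun=> ln_fact_root R (d j))) => [|i /andP[_ /negPf->]]; last first.
    by rewrite subn0.
  rewrite sumr_const -[X in X <= _]mulr_natl.
  suff -> : #|(fun i => (i \notin F) && (j \notin i |: F) && ~~ G j (s i))| =
    (#|~: F| - d j)%N by [].
  rewrite -cA -cardsDS; last first.
    by apply/subsetP => i; rewrite !inE => /andP[].
  apply: eq_card => i; rewrite [LHS]unfold_in in_setU1 negb_or jF andbT !inE.
  have [_ sG] := perms_extendingP _ _ _ _ sS.
  have [<-|_] := eqVneq j i; first by rewrite jF sG.
  by case: (i \notin F) (G j (s i)) => [] [].
apply: le_trans (lerD (lexx _) (ler_sum _ inner)) _.
rewrite sumr_const -[X in _ + X]mulr_natl -mulrDr mulrCA ler_pM2l // mulr_sumr -big_split /=.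
apply: ler_sum => j jF.
have /card_gt0P[s sS] := S0.
have d0 : (0 < d j)%N.
  by apply/card_gt0P; exists (s j); apply: perms_extending_free.
have dM : (d j <= #|~: F|)%N.
  rewrite /d -(card_perms_extending_neighbours jF sS); apply/subset_leq_card.
  by apply/subsetP => i; rewrite !inE => /andP[].
rewrite -/(d j) addrA -lnM ?posrE ?ltr0n ?fact_gt0 // natrB // mulrBl.
have -> : (d j)%:R * (d j).-1`!%:R = (d j)`!%:R :> R.
  by rewrite -natrM; case: (d j) d0.
have -> : ln ((d j)`!%:R) = (d j)%:R * ln_fact_root R (d j).
  by rewrite /ln_fact_root mulrC mulfVK // pnatr_eq0 -lt0n.
by rewrite addrC subrK.
Qed.

Lemma bregman (R : realType) n (G : rel 'I_n) :
  #|[set s : 'S_n | [forall j, G j (s j)]]|%:R <=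
  expR (\sum_j ln_fact_root R #|[set k | G j k]|).
Proof.
case: (posnP #|[set s : 'S_n | [forall j, G j (s j)]]|) => [->|S0].
  exact: expR_ge0.
have SE : perms_extending G set0 1%g = [set s : 'S_n | [forall j, G j (s j)]].
  by apply/setP => s; rewrite !inE; apply: eq_forallb => j; rewrite in_set0.
have := @bregman_extending R n G set0 1%g.
rewrite SE => /(_ S0); rewrite -ler_expR lnK ?posrE ?ltr0n // => H.
apply: le_trans H _; rewrite ler_expR le_eqVlt; apply/orP; left; apply/eqP.
apply: eq_big => [j|j _]; first by rewrite in_set0.
congr ln_fact_root; apply: eq_card => k; rewrite !inE imset0 in_set0.
by rewrite andbT.
Qed.

(** * Counting Latin squares row by row *)

Definition disjoint_perms (n : nat) : rel 'S_n :=
  fun p q => [forall x, p x != q x].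

(* [s] lists the [i] previous rows, the most recent one first. *)
Fixpoint row_extensions (n : nat) (c : nat -> pred 'S_n) (i k : nat)
    (s : seq 'S_n) : seq (seq 'S_n) :=
  if k is k'.+1 then
    flatten [seq [seq p :: t | t <- row_extensions c i.+1 k' (p :: s)]
            | p <- enum [set p | c i p & all (@disjoint_perms n p) s]]
  else [:: [::]].

Lemma disjoint_perms_sym n : symmetric (@disjoint_perms n).
Proof. by move=> p q; apply: eq_forallb => x; rewrite eq_sym. Qed.

(** Unlike [s], the list [t] is in row order, so its entry [j] is row [i + j]. *)
Lemma row_extensionsP n (c : nat -> pred 'S_n) i k s t :
  reflect [/\ size t = k, forall j, (j < k)%N -> c (i + j)%N (nth 1%g t j),
      pairwise (@disjoint_perms n) t & allrel (@disjoint_perms n) t s]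
    (t \in row_extensions c i k s).
Proof.
apply: (iffP idP).
  elim: k i s t => [|k IH] i s t /=.
    by rewrite inE => /eqP ->; split=> // j.
  case/flatten_mapP => p; rewrite mem_enum inE => /andP[cp ps].
  case/mapP => t' /IH[szt ct pt at'] ->.
  move: at'; rewrite allrel_consr => /andP[pt' at'].
  split => /=; rewrite ?szt //.
  - by case=> [|j] jk; rewrite ?addn0 // addnS -addSn; apply: ct.
  - by rewrite pt andbT; apply: sub_all pt' => q; rewrite disjoint_perms_sym.
  - by rewrite allrel_consl ps.
elim: k i s t => [|k IH] i s t /=.
  by case=> /size0nil -> _ _ _; rewrite inE.
case: t => [|p t] [] //= [szt] ct /andP[pt tt].
rewrite allrel_consl => /andP[ps ts].
apply/flatten_mapP; exists p.
  by rewrite mem_enum inE ps andbT; have := ct 0%N isT; rewrite addn0.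
apply: map_f; apply: IH; split=> //.
  by move=> j jk; rewrite addSnnS; apply: (ct j.+1).
rewrite allrel_consr ts andbT; apply: sub_all pt => q.
by rewrite disjoint_perms_sym.
Qed.

Lemma uniq_row_extensions n (c : nat -> pred 'S_n) i k s :
  uniq (row_extensions c i k s).
Proof.
elim: k i s => //= k IH i s; apply: allpairs_uniq_dep => [|p _|].
- exact: enum_uniq.
- exact: IH.
- by move=> [p t] [q u] _ _ /= [-> ->].
Qed.

(** [Inv] carries what the bound on the next row needs to know about the rows already placed. *)
Lemma size_row_extensions_le (R : numDomainType) n (c : nat -> pred 'S_n)
    (b : nat -> R) (Inv : seq 'S_n -> Prop) i k s :
  (forall j, 0 <= b j) ->
  (forall s p, Inv s -> c (size s) p -> all (@disjoint_perms n p) s -> Inv (p :: s)) ->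
  (forall s, (size s < i + k)%N -> Inv s ->
     #|[set p | c (size s) p & all (@disjoint_perms n p) s]|%:R <= b (size s)) ->
  size s = i -> Inv s ->
  (size (row_extensions c i k s))%:R <= \prod_(i <= j < i + k) b j.
Proof.
move=> b0 InvS; elim: k i s => [|k IH] i s bP si sI /=.
  by rewrite addn0 big_geq.
rewrite size_flatten /shape -map_comp sumnE big_map natr_sum big_enum /=.
rewrite big_ltn; last by rewrite addnS ltnS leq_addr.
have P0 : 0 <= \prod_(i.+1 <= j < i + k.+1) b j by rewrite prodr_ge0.
apply: le_trans (ler_wpM2r P0 _); last by rewrite -si; apply: bP; rewrite ?si ?addnS ?ltnS ?leq_addr.
rewrite mulr_natl si -sumr_const.
apply: ler_sum => p; rewrite inE => /andP[cp ps]; rewrite size_map -addSnnS.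
apply: IH => [u uk Iu||]; rewrite /= ?si //; last by apply: InvS; rewrite // si.
by apply: bP => //; rewrite -addSnnS.
Qed.

Lemma size_row_extensions_ge (R : numDomainType) n (c : nat -> pred 'S_n)
    (b : nat -> R) (Inv : seq 'S_n -> Prop) i k s :
  (forall j, 0 <= b j) ->
  (forall s p, Inv s -> c (size s) p -> all (@disjoint_perms n p) s -> Inv (p :: s)) ->
  (forall s, (size s < i + k)%N -> Inv s ->
     b (size s) <= #|[set p | c (size s) p & all (@disjoint_perms n p) s]|%:R) ->
  size s = i -> Inv s ->
  \prod_(i <= j < i + k) b j <= (size (row_extensions c i k s))%:R.
Proof.
move=> b0 InvS; elim: k i s => [|k IH] i s bP si sI /=.
  by rewrite addn0 big_geq.
rewrite size_flatten /shape -map_comp sumnE big_map natr_sum big_enum /=.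
rewrite big_ltn; last by rewrite addnS ltnS leq_addr.
have P0 : 0 <= \prod_(i.+1 <= j < i + k.+1) b j by rewrite prodr_ge0.
apply: le_trans (ler_wpM2r P0 _) _; first by rewrite -[in b i]si; apply: bP; rewrite ?si ?addnS ?ltnS ?leq_addr.
rewrite mulr_natl si -sumr_const.
apply: ler_sum => p; rewrite inE => /andP[cp ps]; rewrite size_map -addSnnS.
apply: IH => [u uk Iu||]; rewrite /= ?si //; last by apply: InvS; rewrite // si.
by apply: bP => //; rewrite -addSnnS.
Qed.

(** * Number of choices for the next row *)

Definition is_free (n : nat) (s : seq 'S_n) (x y : 'I_n) : bool :=
  all (fun q : 'S_n => q x != y) s.

Lemma disjoint_all_is_free n (s : seq 'S_n) (p : 'S_n) :
  all (@disjoint_perms n p) s = [forall x, is_free s x (p x)].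
Proof.
apply/allP/forallP => [H x|H q qs].
  by apply/allP => q qs; have /forallP/(_ x) := H q qs; rewrite eq_sym.
by apply/forallP => x; have /allP/(_ q qs) := H x; rewrite eq_sym.
Qed.

Lemma uniq_row_values n (s : seq 'S_n) x :
  pairwise (@disjoint_perms n) s -> uniq [seq q x | q : 'S_n <- s].
Proof.
move=> ps; rewrite uniq_pairwise pairwise_map.
by apply: sub_pairwise ps => p q /forallP/(_ x).
Qed.

Lemma uniq_row_preimages n (s : seq 'S_n) y :
  pairwise (@disjoint_perms n) s -> uniq [seq (q^-1)%g y | q : 'S_n <- s].
Proof.
move=> ps; rewrite uniq_pairwise pairwise_map.
apply: sub_pairwise ps => p q /forallP/(_ ((p^-1)%g y)) /=; rewrite permKV.
by apply: contraNneq => ->; rewrite permKV.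
Qed.

Lemma card_free_in n (s : seq 'S_n) (Y : {set 'I_n}) x :
  pairwise (@disjoint_perms n) s -> all (fun q : 'S_n => q x \in Y) s ->
  #|[set y | (y \in Y) && is_free s x y]| = (#|Y| - size s)%N.
Proof.
move=> ps sY; pose V := [set y in [seq q x | q : 'S_n <- s]].
have VY : V \subset Y.
  by apply/subsetP => y; rewrite inE => /mapP[q /(allP sY) qY ->].
have cV : #|V| = size s by rewrite cardsE (card_uniqP _) ?size_map ?uniq_row_values.
rewrite -cV -cardsDS //; apply: eq_card => y; rewrite !inE andbC; congr (_ && _).
apply/allP/idP => [H|H q qs].
  by apply/negP => /mapP[q qs yE]; have := H q qs; rewrite yE eqxx.
by apply: contra H => /eqP <-; apply: map_f.
Qed.

Lemma card_free_symbols n (s : seq 'S_n) x :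
  pairwise (@disjoint_perms n) s -> #|[set y | is_free s x y]| = (n - size s)%N.
Proof.
move=> ps; have := @card_free_in n s [set: 'I_n]%SET x ps.
rewrite cardsT card_ord => <-; first by apply: eq_card => y; rewrite !inE.
by apply/allP => q _; rewrite inE.
Qed.

Lemma card_free_columns n (s : seq 'S_n) y :
  pairwise (@disjoint_perms n) s -> #|[set x | is_free s x y]| = (n - size s)%N.
Proof.
move=> ps; pose V := [set x in [seq (q^-1)%g y | q : 'S_n <- s]].
have cV : #|V| = size s.
  by rewrite cardsE (card_uniqP _) ?size_map ?uniq_row_preimages.
rewrite -cV -[X in (X - _)%N]card_ord -cardsT -cardsDS ?subsetT //.
apply: eq_card => x; rewrite !inE andbT.
apply/allP/idP => [H|H q qs].
  by apply/negP => /mapP[q qs xE]; have := H q qs; rewrite xE permKV eqxx.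
by apply: contra H => /eqP <-; apply/mapP; exists q => //; rewrite permK.
Qed.

Lemma next_row_ge n (s : seq 'S_n) : pairwise (@disjoint_perms n) s ->
  ((n - size s) ^ n * n`! <=
   #|[set p : 'S_n | all (@disjoint_perms n p) s]| * n.+1 ^ n)%N.
Proof.
move=> ps; have := @perfect_matchings_ge n (n - size s) (fun y x => is_free s x y).
have -> : [set p : 'S_n | [forall x, is_free s x (p x)]] =
          [set p : 'S_n | all (@disjoint_perms n p) s].
  by apply/setP => p; rewrite !inE disjoint_all_is_free.
apply=> [y|x].
  by rewrite -(card_free_columns y ps); apply: eq_card => x; rewrite !inE.
by rewrite -(card_free_symbols x ps); apply: eq_card => y; rewrite !inE.
Qed.

Lemma next_row_le (R : realType) n (s : seq 'S_n) :
  pairwise (@disjoint_perms n) s ->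
  #|[set p : 'S_n | all (@disjoint_perms n p) s]|%:R <=
  expR (n%:R * ln_fact_root R (n - size s)).
Proof.
move=> ps; have := @bregman R n (is_free s).
rewrite (eq_bigr (fun=> ln_fact_root R (n - size s))) => [|x _]; last first.
  by rewrite card_free_symbols.
rewrite sumr_const card_ord mulr_natl; apply: le_trans.
by rewrite ler_nat; apply/subset_leq_card/subsetP => p; rewrite !inE disjoint_all_is_free.
Qed.

Definition maps_block (n : nat) (B S : {set 'I_n}) (p : 'S_n) : bool :=
  [forall x, (p x \in S) == (x \in B)].

(** Earlier block rows used only symbols of [S] in the columns of [B], and only other symbols
    elsewhere. So the degrees drop by [size s] separately in the two parts. *)
Lemma next_block_row_le (R : realType) n (B S : {set 'I_n}) (s : seq 'S_n) :
  #|B| = #|S| -> pairwise (@disjoint_perms n) s -> all (maps_block B S) s ->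
  #|[set p : 'S_n | maps_block B S p & all (@disjoint_perms n p) s]|%:R <=
  expR (#|S|%:R * ln_fact_root R (#|S| - size s) +
        (n - #|S|)%:R * ln_fact_root R (n - #|S| - size s)).
Proof.
move=> BS ps bs.
pose G x y := ((y \in S) == (x \in B)) && is_free s x y.
have := @bregman R n G.
have degB x : x \in B -> #|[set y | G x y]| = (#|S| - size s)%N.
  move=> xB; rewrite -(@card_free_in n s S x ps).
    by apply: eq_card => y; rewrite !inE /G xB eqb_id.
  by apply: sub_all bs => q /forallP/(_ x); rewrite xB eqb_id.
have degBC x : x \notin B -> #|[set y | G x y]| = (n - #|S| - size s)%N.
  move=> xB; have -> : (n - #|S| = #|~: S|)%N by rewrite [RHS]cardsCs setCK card_ord.
  rewrite -(@card_free_in n s (~: S) x ps).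
    by apply: eq_card => y; rewrite !inE /G (negPf xB) eqbF_neg.
  by apply: sub_all bs => q /forallP/(_ x); rewrite (negPf xB) eqbF_neg inE.
rewrite (bigID (mem B)) /= (eq_bigr (fun=> ln_fact_root R (#|S| - size s))) => [|x xB]; last first.
  by rewrite degB.
rewrite [X in _ + X](eq_bigr (fun=> ln_fact_root R (n - #|S| - size s))) => [|x xB]; last first.
  by rewrite degBC.
rewrite !sumr_const.
have -> : #|(fun x => x \notin B)| = (n - #|S|)%N.
  have -> : (n - #|S| = #|~: B|)%N by rewrite [RHS]cardsCs setCK card_ord BS.
  by apply: eq_card => x; rewrite !inE.
rewrite BS !mulr_natl; apply: le_trans; rewrite ler_nat.
apply/subset_leq_card/subsetP => p; rewrite !inE disjoint_all_is_free.
by move=> /andP[/forallP Hp /forallP Hf]; apply/forallP => x; rewrite /G Hp Hf.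
Qed.

(** * Latin squares and subsquares as sequences of rows *)

Lemma latin_square_row_inj n (L : 'M['I_n]_n) i :
  latin_square L -> injective (L i).
Proof.
case/and5P => _ _ _ /forall_inP/(_ i (in_setT _))/forall_inP H _ x y Lxy.
have /cards1P[z zE] := H (L i x) (in_setT _).
have xz : x \in [set z] by rewrite -zE !inE eqxx.
have yz : y \in [set z] by rewrite -zE !inE Lxy eqxx.
by move: xz yz; rewrite !inE => /eqP -> /eqP ->.
Qed.

Lemma latin_square_col_inj n (L : 'M['I_n]_n) x :
  latin_square L -> injective (fun i => L i x).
Proof.
case/and5P => _ _ _ _ /forall_inP/(_ x (in_setT _))/forall_inP H i j Lij.
have /cards1P[z zE] := H (L i x) (in_setT _).
have iz : i \in [set z] by rewrite -zE !inE eqxx.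
have jz : j \in [set z] by rewrite -zE !inE Lij eqxx.
by move: iz jz; rewrite !inE => /eqP -> /eqP ->.
Qed.

Lemma latin_squareP n (L : 'M['I_n]_n) :
  (forall i, injective (L i)) -> (forall x, injective (fun i => L i x)) ->
  latin_square L.
Proof.
move=> rowI colI; rewrite /latin_square /latin_subarray !eqxx /=.
apply/and3P; split.
- by apply/forall_inP => i _; apply/forall_inP => j _; rewrite inE.
- apply/forall_inP => i _; apply/forall_inP => s _; apply/cards1P.
  exists (invF (rowI i) s); apply/setP => x; rewrite !inE.
  by rewrite (can2_eq (invF_f (rowI i)) (f_invF (rowI i))).
- apply/forall_inP => x _; apply/forall_inP => s _; apply/cards1P.
  exists (invF (colI x) s); apply/setP => i; rewrite !inE.
  by rewrite (can2_eq (invF_f (colI x)) (f_invF (colI x))).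
Qed.

(** In a row of [A] every symbol of [S] already occurs within [B], hence nowhere else. So the rows
    of [A] satisfy [maps_block]. *)
Lemma latin_square_block n (L : 'M['I_n]_n) (A B S : {set 'I_n}) i x :
  latin_square L -> latin_subarray L A B S -> i \in A ->
  (L i x \in S) = (x \in B).
Proof.
move=> Ll /and5P[_ _ /forall_inP Lin /forall_inP Lrow _] iA.
apply/idP/idP => [LS|xB]; last by have /forall_inP := Lin i iA; apply.
have /forall_inP/(_ _ LS)/cards1P[z zE] := Lrow i iA.
have : z \in [set z] by rewrite set11.
rewrite -zE inE => /andP[zB /eqP Lz].
by rewrite -(latin_square_row_inj Ll Lz).
Qed.

(** Take a row outside [A]. In a column of [B] the symbols of [S] are all used up by the rows of
    [A], so this row places #|A| distinct symbols outside [S]. *)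
Lemma latin_subarray_half n (L : 'M['I_n]_n) (A B S : {set 'I_n}) :
  latin_square L -> latin_subarray L A B S -> (#|A| < n)%N -> (#|A| <= n - #|A|)%N.
Proof.
move=> Ll LS An; have /and5P[/eqP cB /eqP cS _ _ /forall_inP Lcol] := LS.
have [i iA] : exists i, i \in ~: A.
  by apply/set0Pn; rewrite -card_gt0 cardsCs setCK card_ord subn_gt0.
have -> : (n - #|A| = #|~: S|)%N by rewrite [RHS]cardsCs setCK card_ord cS.
rewrite -[X in (X <= _)%N]cB -(card_imset _ (@latin_square_row_inj _ _ i Ll)).
apply/subset_leq_card/subsetP => s /imsetP[x xB ->]; rewrite inE; apply/negP => sS.
have /forall_inP/(_ _ sS)/cards1P[z zE] := Lcol x xB.
have : z \in [set z] by rewrite set11.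
rewrite -zE inE => /andP[zA /eqP Lz].
by move: iA; rewrite inE -(@latin_square_col_inj _ _ x Ll _ _ Lz) zA.
Qed.

(** Total in [L]: the identity is the default when row [i] is not a permutation. *)
Definition row_perm_of n (L : 'M['I_n]_n) (i : 'I_n) : 'S_n :=
  odflt 1%g [pick p : 'S_n | [forall x, p x == L i x]].

Lemma row_perm_ofE n (L : 'M['I_n]_n) i x :
  latin_square L -> row_perm_of L i x = L i x.
Proof.
move=> Ll; rewrite /row_perm_of; case: pickP => [p /forallP/(_ x)/eqP //|].
move/(_ (perm (latin_square_row_inj (i := i) Ll)))/negP; case.
by apply/forallP => y; rewrite permE.
Qed.

Lemma card_latin_squares_ge (R : realFieldType) n :
  \prod_(0 <= j < n) (((n - j) ^ n * n`!)%:R / (n.+1 ^ n)%:R) <=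
  #|latin_squares n|%:R :> R.
Proof.
pose c (i : nat) : pred 'S_n := xpredT.
apply: le_trans (_ : (size (row_extensions c 0 n [::]))%:R <= _).
  apply: (@size_row_extensions_ge _ _ _ _ (fun s => pairwise (@disjoint_perms n) s) 0 n).
  - by move=> j; rewrite divr_ge0 ?ler0n.
  - by move=> s p ps _ /= ->.
  - move=> s _ ps; rewrite ler_pdivrMr ?ltr0n ?expn_gt0 // -natrM ler_nat.
    apply: leq_trans (next_row_ge ps) _; rewrite leq_mul2r; apply/orP; right.
    by apply/subset_leq_card/subsetP => p; rewrite !inE.
  - by [].
  - by [].
rewrite ler_nat.
pose mx (t : seq 'S_n) : 'M['I_n]_n := \matrix_(i, x) nth 1%g t i x.
have mxI : {in row_extensions c 0 n [::] &, injective mx}.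
  move=> t u /row_extensionsP[szt _ _ _] /row_extensionsP[szu _ _ _] E.
  apply: (@eq_from_nth _ 1%g); first by rewrite szt szu.
  move=> i; rewrite szt => ilt; apply/permP => x.
  by move/matrixP/(_ (Ordinal ilt) x): E; rewrite !mxE.
rewrite -(size_map mx) cardE; apply: uniq_leq_size.
  by rewrite map_inj_in_uniq // uniq_row_extensions.
move=> L /mapP[t /row_extensionsP[szt _ pt _] ->].
rewrite mem_enum inE; apply: latin_squareP => [i x y|x i j].
  by rewrite !mxE; apply: perm_inj.
rewrite !mxE => E; apply/eqP; move: E; apply: contra_eqT => ij.
wlog : i j ij / (i < j)%N.
  move=> W; case: (ltngtP i j) => [|ji|/val_inj E]; first exact: W.
    by rewrite eq_sym; apply: W => //; rewrite eq_sym.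
  by rewrite E eqxx in ij.
move=> lij; move/(pairwiseP 1%g): pt => /(_ i j); rewrite !inE szt => /(_ _ _ lij).
by move=> /(_ (ltn_ord i) (ltn_ord j)) /forallP/(_ x).
Qed.

Lemma card_latin_subarray_le (R : realType) n (A B S : {set 'I_n}) :
  #|B| = #|A| -> #|S| = #|A| ->
  #|[set L : 'M['I_n]_n | latin_square L & latin_subarray L A B S]|%:R <=
  \prod_(0 <= j < n) expR (if (j < #|A|)%N then
     #|A|%:R * ln_fact_root R (#|A| - j) + (n - #|A|)%:R * ln_fact_root R (n - #|A| - j)
     else n%:R * ln_fact_root R (n - j)).
Proof.
move=> BA SA; set m := #|A|.
pose c (i : nat) (p : 'S_n) := (i < m)%N ==> maps_block B S p.
apply: le_trans (_ : (size (row_extensions c 0 n [::]))%:R <= _); last first.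
  (* The block condition has to be remembered only until the [m] rows of [A] are placed. *)
  apply: (@size_row_extensions_le _ _ _ _ (fun s => pairwise (@disjoint_perms n) s /\
     ((size s <= m)%N -> all (maps_block B S) s)) 0 n).
  - by move=> j; rewrite expR_ge0.
  - move=> s p [ps bs] cp /= ap; split; first by rewrite ps ap.
    by move=> sm; rewrite bs ?(ltnW sm) // andbT; move: cp; rewrite /c sm.
  - move=> s _ [ps bs]; case: ifPn => sm.
      have := next_block_row_le R (etrans BA (esym SA)) ps (bs (ltnW sm)).
      rewrite SA; apply: le_trans; rewrite ler_nat.
      by apply/subset_leq_card/subsetP => p; rewrite !inE /c sm.
    apply: le_trans (next_row_le R ps); rewrite ler_nat.
    by apply/subset_leq_card/subsetP => p; rewrite !inE => /andP[].
  - by [].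
  - by [].
(* Reading the rows in the order [e], with those of [A] first, embeds the squares into the row
   sequences just counted. *)
rewrite ler_nat; pose e := enum A ++ enum (~: A).
have ue : uniq e.
  rewrite cat_uniq !enum_uniq andbT; apply/hasPn => i.
  by rewrite !mem_enum inE.
have sze : size e = n by rewrite size_cat -!cardE cardsC card_ord.
rewrite cardE -(size_map (fun L => [seq row_perm_of L i | i <- e])).
apply: uniq_leq_size.
  rewrite map_inj_in_uniq ?enum_uniq // => L L'.
  rewrite !mem_enum !inE => /andP[Ll _] /andP[Ll' _] /eq_in_map E.
  apply/matrixP => i x; rewrite -!row_perm_ofE // E //.
  by rewrite mem_cat !mem_enum inE orbN.
move=> t /mapP[L]; rewrite mem_enum inE => /andP[Ll LS] ->.
apply/row_extensionsP; split.
- by rewrite size_map.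
- move=> j jn; rewrite /c add0n; apply/implyP => jm.
  have i0 := Ordinal jn.
  rewrite (nth_map i0) ?sze //; apply/forallP => x.
  rewrite row_perm_ofE // (latin_square_block x Ll LS) //.
  by rewrite nth_cat -cardE jm -mem_enum mem_nth // -cardE.
- rewrite pairwise_map; move: ue; rewrite uniq_pairwise.
  apply: sub_pairwise => i j ij; apply/forallP => x.
  rewrite !row_perm_ofE //; apply: contraNneq ij.
  by move/(latin_square_col_inj Ll) => ->.
- by rewrite allrel0r.
Qed.

(** * Estimates *)

Lemma ln_le_subr1 (R : realType) (x : R) : 0 < x -> ln x <= x - 1.
Proof.
by move=> x0; have := @le_ln1Dx R (x - 1); rewrite addrCA subrr addr0; apply; lra.
Qed.

Lemma ln_succ_le (R : realType) (r : nat) : (0 < r)%N ->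
  ln (r.+1%:R : R) - ln r%:R <= r%:R^-1.
Proof.
move=> r0; have r0' : 0 < r%:R :> R by rewrite ltr0n.
rewrite -ln_div ?posrE ?ltr0n //; apply: le_trans (ln_le_subr1 _) _.
  by rewrite divr_gt0 ?ltr0n.
by rewrite -natr1 mulrDl mulfV ?gt_eqF // mul1r addrAC subrr add0r.
Qed.

Lemma ln_succ_ge (R : realType) (r : nat) : (0 < r)%N ->
  r.+1%:R^-1 <= ln (r.+1%:R : R) - ln r%:R.
Proof.
move=> r0; have r0' : 0 < r%:R :> R by rewrite ltr0n.
have s0' : 0 < r.+1%:R :> R by rewrite ltr0n.
rewrite -[leRHS]opprB lerNr -ln_div ?posrE ?ltr0n //.
apply: le_trans (ln_le_subr1 _) _; first by rewrite divr_gt0.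
rewrite -[r%:R](addrK 1) natr1 mulrBl mulfV ?gt_eqF // mul1r.
by rewrite addrAC subrr add0r.
Qed.

(** Crude Stirling bounds, here and in [ln_fact_le]: the induction steps use that ln(r+1) - ln r
    lies between 1/(r+1) and 1/r. *)
Lemma ln_fact_ge (R : realType) (r : nat) : (0 < r)%N ->
  r%:R * (ln r%:R - 1) <= ln (r`!%:R : R).
Proof.
case: r => // r _; elim: r => [|r IH]; first by rewrite ln1 mul1r sub0r lerN10.
rewrite factS natrM lnM ?posrE ?ltr0n ?fact_gt0 //.
have := @ln_succ_le R r.+1 isT; move: IH.
have r0 : 0 < r.+1%:R :> R by rewrite ltr0n.
rewrite -[r.+2%:R]natr1; move: (r.+1%:R : R) r0 => x x0 H.
move=> /(ler_wpM2l (ltW x0)); rewrite mulfV ?gt_eqF //; nra.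
Qed.

Lemma ln_fact_le (R : realType) (r : nat) : (0 < r)%N ->
  ln (r`!%:R : R) <= r%:R * (ln r%:R - 1) + ln r%:R + 1.
Proof.
case: r => // r _; elim: r => [|r IH]; first by rewrite ln1 mul1r; lra.
rewrite factS natrM lnM ?posrE ?ltr0n ?fact_gt0 //.
have := @ln_succ_ge R r.+1 isT; move: IH.
have r0 : 0 < r.+2%:R :> R by rewrite ltr0n.
rewrite -[r.+1%:R](addrK 1) natr1; move: (r.+2%:R : R) r0 => x x0 H.
move=> /(ler_wpM2l (ltW x0)); rewrite mulfV ?gt_eqF //; nra.
Qed.

Lemma ln_fact_root_ge (R : realType) (r : nat) : (0 < r)%N ->
  ln r%:R - 1 <= ln_fact_root R r.
Proof.
by move=> r0; rewrite ler_pdivlMr ?ltr0n // mulrC ln_fact_ge.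
Qed.

Lemma ln_fact_root_le (R : realType) (r : nat) : (0 < r)%N ->
  ln_fact_root R r <= ln r%:R - 1 + (ln r%:R + 1) / r%:R.
Proof.
move=> r0; rewrite ler_pdivrMr ?ltr0n // mulrDl mulfVK ?pnatr_eq0 -?lt0n //.
by rewrite addrA mulrC ln_fact_le.
Qed.

Lemma fact_le_succ_expn (r : nat) : (r`! <= r.+1 ^ r)%N.
Proof.
elim: r => // r IH; rewrite factS expnS leq_mul //.
by apply: leq_trans IH _; case: r => // r; rewrite leq_exp2r.
Qed.

(** The r-th root of r! increases with r because r! is at most (r+1)^r. *)
Lemma ln_fact_root_homo (R : realType) (r s : nat) : (r <= s)%N ->
  ln_fact_root R r <= ln_fact_root R s.
Proof.
move=> /subnKC <-; elim: (s - r)%N => [|k IH]; first by rewrite addn0.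
rewrite addnS; apply: le_trans IH _; move: (r + k)%N => {r s k} r.
case: r => [|r]; first by rewrite /ln_fact_root fact0 ln1 !mul0r.
rewrite /ln_fact_root ler_pdivrMr ?ltr0n // mulrAC ler_pdivlMr ?ltr0n //.
have key : ln (r.+1`!%:R : R) <= ln r.+2%:R * r.+1%:R.
  rewrite mulr_natr -lnXn ?ltr0n // -natrX.
  rewrite ler_ln ?posrE ?ltr0n ?expn_gt0 ?fact_gt0 //.
  by rewrite ler_nat fact_le_succ_expn.
rewrite [in leRHS]factS natrM lnM ?posrE ?ltr0n ?fact_gt0 //.
by rewrite mulrDl -[r.+2%:R in leLHS]natr1 mulrDr mulr1 addrC lerD2r.
Qed.

Lemma harmonic_le (R : realType) (n : nat) : (0 < n)%N ->
  \sum_(0 <= j < n) ((n - j)%:R^-1 : R) <= ln n%:R + 1.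
Proof.
move=> n0; rewrite big_nat_rev /= add0n.
have -> : \sum_(0 <= j < n) ((n - (n - j.+1))%:R^-1 : R) = \sum_(0 <= j < n) (j.+1%:R^-1 : R).
  by apply: eq_big_nat => j jn; rewrite subKn.
case: n n0 => // n _; elim: n => [|n IH]; first by rewrite big_nat1 ln1 invr1 add0r.
rewrite big_nat_recr //=; apply: le_trans (lerD IH (@ln_succ_ge R n.+1 isT)) _.
by rewrite addrC addrA subrK.
Qed.

(** Bounds the logarithm of the ratio between the upper bound for row [j] and the lower bound for
    the same row. The 1 comes from ((n+1)/n)^n, the fractions with ln n + 1 from Stirling's error,
    and m ln(n/m) is the gain of a block row. *)
Definition row_gap (R : realType) (n m j : nat) : R :=
  1 + n%:R * ((ln n%:R + 1) / (n - j)%:R) +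
  (if (j < m)%N then
     m%:R * ((ln n%:R + 1) / (m - j)%:R) - m%:R * ln (n%:R / m%:R) else 0).

Lemma row_count_gap (R : realType) (n m j : nat) :
  (0 < m)%N -> (m <= n - m)%N -> (j < n)%N ->
  expR (if (j < m)%N then
     m%:R * ln_fact_root R (m - j) + (n - m)%:R * ln_fact_root R (n - m - j)
     else n%:R * ln_fact_root R (n - j)) <=
  ((n - j) ^ n * n`!)%:R / (n.+1 ^ n)%:R * expR (row_gap R n m j).
Proof.
move=> m0 mn jn; have n0 : (0 < n)%N by lia.
pose lam : R := ln n%:R; have nR : 0 < n%:R :> R by rewrite ltr0n.
have nj0 : (0 < n - j)%N by rewrite subn_gt0.
have njR : 0 < (n - j)%:R :> R by rewrite ltr0n.
have ln_le_lam k : (0 < k <= n)%N -> ln k%:R <= lam.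
  by case/andP=> k0 kn; rewrite ler_ln ?posrE ?ltr0n // ler_nat.
have full : n%:R * ln_fact_root R (n - j) <=
    n%:R * (ln (n - j)%:R - 1) + n%:R * ((lam + 1) / (n - j)%:R).
  rewrite -mulrDr ler_pM2l //; apply: le_trans (ln_fact_root_le R nj0) _.
  rewrite lerD2l ler_pM2r ?invr_gt0 // lerD2r ln_le_lam // nj0 leq_subr //.
have base : n%:R * (ln (n - j)%:R - 1) <=
    ln (((n - j) ^ n * n`!)%:R / (n.+1 ^ n)%:R) + 1 :> R.
  have p1 : (0 < (n - j) ^ n * n`!)%N by rewrite muln_gt0 expn_gt0 nj0 fact_gt0.
  rewrite ln_div ?posrE ?ltr0n ?expn_gt0 // natrM lnM ?posrE ?ltr0n ?expn_gt0 ?nj0 ?fact_gt0 //.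
  rewrite !natrX !lnXn ?ltr0n // -[ln (n - j)%:R *+ n]mulr_natl -[ln n.+1%:R *+ n]mulr_natl.
  have := ln_fact_ge R n0; have := ln_succ_le R n0.
  move=> /(ler_wpM2l (ltW nR)); rewrite mulfV ?gt_eqF //.
  by rewrite -/lam mulrBr; lra.
have b0 : 0 < ((n - j) ^ n * n`!)%:R / (n.+1 ^ n)%:R :> R.
  by rewrite divr_gt0 ?ltr0n ?muln_gt0 ?expn_gt0 ?nj0 ?fact_gt0.
rewrite -[X in _ <= X * _]lnK ?posrE // -expRD ler_expR.
rewrite /row_gap -/lam; case: ifPn => jm; last by lra.
have mj0 : (0 < m - j)%N by rewrite subn_gt0.
have mR : 0 < m%:R :> R by rewrite ltr0n.
(* No gain is kept from the columns outside the block; all of it comes from [block]. *)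
have shift : ln_fact_root R (n - m - j) <= ln_fact_root R (n - j).
  by apply: ln_fact_root_homo; lia.
have block : ln_fact_root R (m - j) <=
    ln_fact_root R (n - j) - ln (n%:R / m%:R) + (lam + 1) / (m - j)%:R.
  have := ln_fact_root_le R mj0; have := ln_fact_root_ge R nj0.
  have : (ln (m - j)%:R + 1) / (m - j)%:R <= (lam + 1) / (m - j)%:R.
    by rewrite ler_pM2r ?invr_gt0 ?ltr0n // lerD2r ln_le_lam //; lia.
  (* As m <= n, the ratio (m-j)/(n-j) is at most m/n. *)
  have : ln (n%:R / m%:R) <= ln (n - j)%:R - ln (m - j)%:R :> R.
    rewrite -ln_div ?posrE ?ltr0n // ler_ln ?posrE ?divr_gt0 ?ltr0n //.
    rewrite ler_pdivrMr // mulrAC ler_pdivlMr ?ltr0n // -!natrM ler_nat.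
    nia.
  lra.
have mn' : m%:R + (n - m)%:R = n%:R :> R by rewrite -natrD subnKC //; lia.
have nm0 : 0 <= (n - m)%:R :> R by rewrite ler0n.
have H1 := ler_wpM2l (ltW mR) block; have H2 := ler_wpM2l nm0 shift.
have H3 : n%:R * ln_fact_root R (n - j) = m%:R * ln_fact_root R (n - j) + (n - m)%:R * ln_fact_root R (n - j).
  by rewrite -mulrDl mn'.
by move: H1; rewrite mulrDr mulrBr; lra.
Qed.

Lemma sum_row_gap (R : realType) (n m : nat) : (0 < m)%N -> (m <= n - m)%N ->
  \sum_(0 <= j < n) row_gap R n m j <=
  n%:R + 2 * n%:R * (ln n%:R + 1) ^+ 2 - m%:R ^+ 2 * ln (n%:R / m%:R).
Proof.
move=> m0 mn; have n0 : (0 < n)%N by lia.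
rewrite /row_gap; set lam : R := ln n%:R.
have lam0 : 0 <= lam by rewrite ln_ge0 // ler1n.
have nR : 0 < n%:R :> R by rewrite ltr0n.
rewrite !big_split /= -mulr_sumr -mulr_sumr.
have -> : \sum_(0 <= j < n) 1 = n%:R :> R by rewrite big_const_nat subn0 iter_addr_0.
have -> : \sum_(0 <= j < n) (if (j < m)%N then
      m%:R * ((lam + 1) / (m - j)%:R) - m%:R * ln (n%:R / m%:R) else 0) =
    m%:R * ((lam + 1) * \sum_(0 <= j < m) (m - j)%:R^-1) - m%:R ^+ 2 * ln (n%:R / m%:R).
  rewrite -big_mkcond -(big_nat_widen 0 m n xpredT) /=; last by lia.
  rewrite big_split /= -!mulr_sumr big_const_nat subn0 iter_addr_0.
  by rewrite -[_ *+ m]mulr_natl; ring.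
have Hn := harmonic_le R n0; have Hm := harmonic_le R m0.
have {}Hm : m%:R * ((lam + 1) * \sum_(0 <= j < m) (m - j)%:R^-1) <= n%:R * (lam + 1) ^+ 2.
  have s0 : 0 <= \sum_(0 <= j < m) ((m - j)%:R^-1 : R).
    by rewrite sumr_ge0 // => j _; rewrite invr_ge0 ler0n.
  apply: ler_pM; rewrite ?ler0n ?mulr_ge0 ?addr_ge0 ?ler_nat //.
    exact: leq_trans mn (leq_subr _ _).
  rewrite expr2 ler_wpM2l ?addr_ge0 //; apply: le_trans Hm _; rewrite lerD2r.
  by rewrite ler_ln ?posrE ?ltr0n // ler_nat; lia.
have {}Hn : n%:R * ((lam + 1) * \sum_(0 <= j < n) (n - j)%:R^-1) <= n%:R * (lam + 1) ^+ 2.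
  by rewrite ler_wpM2l ?ler0n // expr2 ler_wpM2l ?addr_ge0.
lra.
Qed.

Lemma card_latin_block_le (R : realType) (n : nat) (A B S : {set 'I_n}) :
  (0 < #|A|)%N -> (#|A| <= n - #|A|)%N ->
  #|[set L : 'M['I_n]_n | latin_square L & latin_subarray L A B S]|%:R <=
  #|latin_squares n|%:R * expR (n%:R + 2 * n%:R * (ln n%:R + 1) ^+ 2 -
     #|A|%:R ^+ 2 * ln (n%:R / #|A|%:R)) :> R.
Proof.
move=> A0 An; set X := [set L | _].
(* A member of [X] supplies the equal sizes of [A], [B] and [S]. *)
have [->|[L]] := set_0Vmem X; first by rewrite cards0 mulr_ge0 ?expR_ge0.
rewrite inE => /andP[_ /and5P[/eqP BA /eqP SA _ _ _]].
apply: le_trans (card_latin_subarray_le R BA SA) _.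
apply: le_trans (_ : \prod_(0 <= j < n) (((n - j) ^ n * n`!)%:R / (n.+1 ^ n)%:R *
    expR (row_gap R n #|A| j)) <= _).
  rewrite big_nat [leRHS]big_nat; apply: ler_prod => j /andP[_ jn].
  by rewrite expR_ge0 /= row_count_gap.
rewrite big_split /= -expR_sum; apply: ler_pM.
- by apply: prodr_ge0 => j _; rewrite divr_ge0 ?ler0n.
- exact: expR_ge0.
- exact: card_latin_squares_ge.
- by rewrite ler_expR sum_row_gap.
Qed.

(** * Union bound and choice of the exponent *)

Lemma prob_no_large_subsquare_ge (R : realType) (n : nat) (x D : R) :
  (forall m, (0 < m)%N -> (m <= n - m)%N -> x < m%:R ->
     n%:R + 2 * n%:R * (ln n%:R + 1) ^+ 2 - m%:R ^+ 2 * ln (n%:R / m%:R) <= D) ->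
  1 - expR (3 * n%:R + D) <=
  finset_uniform_prob R (latin_squares n) (fun L => ~~ has_proper_subsquare_gt x L).
Proof.
move=> HD; pose bad := [set L in latin_squares n | has_proper_subsquare_gt x L].
pose N : R := #|latin_squares n|%:R.
(* Latin squares exist because the lower bound on their number is positive. *)
have N0 : 0 < N.
  apply: lt_le_trans (card_latin_squares_ge R n).
  rewrite big_nat; apply: prodr_gt0 => j /andP[_ jn].
  by rewrite divr_gt0 ?ltr0n ?muln_gt0 ?expn_gt0 ?subn_gt0 ?jn ?fact_gt0.
have probE : finset_uniform_prob R (latin_squares n)
    (fun L => ~~ has_proper_subsquare_gt x L) = 1 - #|bad|%:R / N.
  rewrite /finset_uniform_prob -/N.
  have -> : #|[set L in latin_squares n | ~~ has_proper_subsquare_gt x L]| =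
            (#|latin_squares n| - #|bad|)%N.
    rewrite -cardsDS; last by apply/subsetP => L; rewrite inE => /andP[].
    apply: eq_card => L; rewrite !inE negb_and [RHS]andbC.
    by case: (latin_square L).
  rewrite natrB ?mulrBl ?mulfV ?gt_eqF //.
  by apply/subset_leq_card/subsetP => L; rewrite inE => /andP[].
rewrite probE lerD2l lerN2 ler_pdivrMr //.
(* Union bound over the triples of rows, columns and symbols: there are at most 8^n of them, and 2
   <= e turns this into exp(3n). *)
pose T := ({set 'I_n} * {set 'I_n} * {set 'I_n})%type.
pose blk (t : T) := [set L : 'M['I_n]_n | latin_square L & latin_subarray L t.1.1 t.1.2 t.2].
pose ok (t : T) := [&& (0 < #|t.1.1|)%N, (#|t.1.1| <= n - #|t.1.1|)%N & x < #|t.1.1|%:R].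
have cover_bad : (#|bad| <= \sum_(t : T | ok t) #|blk t|)%N.
  apply: leq_trans (_ : \sum_(t : T | ok t) \sum_(L in bad) (L \in blk t) <= _)%N;
    last first.
    apply: leq_sum => t _; rewrite -sum1_card [leqRHS]big_mkcond /=.
    rewrite [leqLHS]big_mkcond /=; apply: leq_sum => L _.
    by case: (L \in bad); case: (L \in blk t).
  rewrite exchange_big /= -sum1_card; apply: leq_sum => L.
  rewrite !inE => /andP[Ll /existsP[A /existsP[B /andP[/andP[/existsP[S LS] /andP[A2 An]] xA]]]].
  rewrite (bigD1 (A, B, S)) /=; first by rewrite inE Ll LS add1n.
  by rewrite /ok /= (ltnW A2) xA (latin_subarray_half Ll LS An).
apply: le_trans (_ : (\sum_(t : T | ok t) #|blk t|)%N%:R <= _); first by rewrite ler_nat.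
rewrite natr_sum; apply: le_trans (_ : \sum_(t : T | ok t) N * expR D <= _).
  apply: ler_sum => t /and3P[A0 An xA]; apply: le_trans (card_latin_block_le R _ _ A0 An) _.
  by rewrite ler_pM2l // ler_expR HD.
rewrite sumr_const -[X in X <= _]mulr_natl expRD [leRHS]mulrC mulrCA ler_pM2l //.
rewrite ler_wpM2r ?expR_ge0 //; apply: le_trans (_ : (2 ^ n * 2 ^ n * 2 ^ n)%N%:R <= _).
  rewrite ler_nat; apply: leq_trans (max_card _) _.
  by rewrite !card_prod -!cardsT -!powersetT !card_powerset !cardsT !card_ord.
have two : (2 ^ n)%N%:R <= expR n%:R :> R.
  rewrite natrX -[n%:R]mulr1 mulrC expRM_natr lerXn2r ?nnegrE ?ler0n ?expR_ge0 //.
  by have := @expR_ge1Dx R 1; rewrite -natr1.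
have -> : 3 * n%:R = n%:R + n%:R + n%:R :> R by ring.
rewrite !natrM !expRD; have h0 : 0 <= (2 ^ n)%N%:R :> R by rewrite ler0n.
by rewrite !ler_pM ?mulr_ge0.
Qed.

(** If m is at most n^(3/4), then ln(n/m) is of order ln n and the lower bound on m suffices.
    Otherwise m^2 exceeds n by a factor n^(1/2), which beats every power of ln n, and ln(n/m) >= 1/2
    is enough. *)
Lemma subsquare_exponent_le (R : realType) (eps : R) (n m : nat) :
  let lam := ln (n%:R : R) in
  0 < eps -> 1 <= lam -> 52 <= lam `^ eps ->
  4 * (ln 26 + (2 + eps) * ln (4 * (2 + eps))) <= lam ->
  (0 < m)%N -> (m <= n - m)%N ->
  n%:R `^ (2^-1) * lam `^ (2^-1 + eps) < m%:R ->
  3 * n%:R + (n%:R + 2 * n%:R * (lam + 1) ^+ 2 - m%:R ^+ 2 * ln (n%:R / m%:R)) <=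
  - (n%:R * lam `^ (2 + eps)).
Proof.
move=> lam e0 l1 le52 lbig m0 mn xm.
have mn2 : (2 * m <= n)%N by lia.
have n0 : (0 < n)%N by lia.
have nR : 0 < n%:R :> R by rewrite ltr0n.
have mR : 0 < m%:R :> R by rewrite ltr0n.
have l0 : 0 < lam by lra.
have lp0 : 0 < lam `^ (2 + eps) by rewrite powR_gt0.
have lsq : lam ^+ 2 <= lam `^ (2 + eps).
  by rewrite -(powR_mulrn _ (ltW l0)); apply: ler_powR => //; lra.
(* The positive terms cost 3 + 1 + 2 + 4 + 2 = 12 multiples of n lam^(2+eps), and one more is the
   target. The thresholds 52 = 4 * 13 and 26 = 2 * 13 compensate the factors lam/4 and 1/2. *)
suff : 13 * (n%:R * lam `^ (2 + eps)) <= m%:R ^+ 2 * ln (n%:R / m%:R).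
  have H : n%:R * lam ^+ 2 <= n%:R * lam `^ (2 + eps) by rewrite ler_pM2l.
  have H1 : n%:R * lam <= n%:R * lam ^+ 2 by rewrite ler_pM2l // expr2 ler_peMr // ltW.
  have H2 : n%:R <= n%:R * lam by rewrite ler_peMr // ltW.
  have -> : 2 * n%:R * (lam + 1) ^+ 2 =
    2 * (n%:R * lam ^+ 2) + 4 * (n%:R * lam) + 2 * n%:R by ring.
  lra.
have q0 : 0 < n%:R / m%:R :> R by rewrite divr_gt0.
case: (leP (lam / 4) (ln (n%:R / m%:R))) => [large|small].
  have xsq : n%:R * lam `^ (1 + 2 * eps) <= m%:R ^+ 2.
    have -> : n%:R * lam `^ (1 + 2 * eps) =
        (n%:R `^ (2^-1) * lam `^ (2^-1 + eps)) ^+ 2 :> R.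
      rewrite exprMn -!powR_mulrn ?powR_ge0 // -!powRrM.
      have -> : 2^-1 * 2 = 1 :> R by field.
      rewrite powRr1 ?ler0n //.
      by congr (_ * _ `^ _); field.
    by rewrite lerXn2r ?nnegrE ?mulr_ge0 ?powR_ge0 // ltW.
  apply: le_trans (_ : n%:R * lam `^ (1 + 2 * eps) * (lam / 4) <= _); last first.
    by rewrite ler_pM ?mulr_ge0 ?powR_ge0 //; lra.
  have E : lam `^ (1 + 2 * eps) * lam = lam `^ (2 + eps) * lam `^ eps.
    rewrite -[X in _ * X = _](powRr1 (ltW l0)) -!powRD ?(gt_eqF l0) ?implybT //.
    by congr (_ `^ _); ring.
  have -> : n%:R * lam `^ (1 + 2 * eps) * (lam / 4) =
      n%:R * lam `^ (2 + eps) * (lam `^ eps / 4) :> R.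
    by rewrite -!mulrA [lam `^ _ * (lam / 4)]mulrA E !mulrA.
  by rewrite mulrC ler_pM2l ?mulr_gt0 //; lra.
have lnq : ln (n%:R / m%:R) = lam - ln m%:R :> R by rewrite ln_div ?posrE.
have msq : n%:R * expR (lam / 2) <= m%:R ^+ 2.
  rewrite -[X in X * _ <= _]lnK ?posrE // -[X in _ <= X ^+ _]lnK ?posrE //.
  by rewrite -expRM_natl -expRD ler_expR -/lam; move: small; rewrite lnq; lra.
have half : 2^-1 <= ln (n%:R / m%:R) :> R.
  have mn2' : m%:R / n%:R <= 2^-1 :> R.
    by rewrite ler_pdivrMr // ler_pdivlMl ?ltr0n // -natrM ler_nat.
  have := ln_le_subr1 (divr_gt0 mR nR); rewrite ln_div ?posrE // lnq -/lam.
  lra.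
(* Applying ln x <= x - 1 to x = lam / (4 (2 + eps)) bounds (2 + eps) ln lam by lam/4 plus a
   constant; the remaining lam/4 absorbs the constants. *)
have lgrow : 26 * lam `^ (2 + eps) <= expR (lam / 2).
  have p0 : 0 < 2 + eps by lra.
  have q4 : 0 < 4 * (2 + eps) by lra.
  rewrite -[26]lnK ?posrE // /powR gt_eqF // -expRD ler_expR.
  have := ln_le_subr1 (divr_gt0 l0 q4); rewrite ln_div ?posrE //.
  move=> /(ler_wpM2l (ltW p0)).
  have -> : (2 + eps) * (lam / (4 * (2 + eps)) - 1) = lam / 4 - (2 + eps).
    by field; rewrite gt_eqF.
  lra.
have F : n%:R * expR (lam / 2) * 2^-1 <= m%:R ^+ 2 * ln (n%:R / m%:R).
  by apply: ler_pM; rewrite ?mulr_ge0 ?expR_ge0 ?invr_ge0 ?ler0n.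
by have := ler_wpM2l (ltW nR) lgrow; lra.
Qed.

Local Open Scope classical_set_scope.

Theorem theorem1p2 (R : realType) (eps : R) (eps_gt0 : 0 < eps) :
  exists f : nat -> R,
    (f n / (n%:R * ln (n%:R : R) ^+ 2) @[n --> \oo] --> +oo) /\
    (forall n : nat, (0 < n)%N ->
       1 - expR (- f n) <=
       finset_uniform_prob R (latin_squares n)
         (fun L => ~~ has_proper_subsquare_gt
                        ((n%:R : R) `^ (2^-1) * ln (n%:R : R) `^ (2^-1 + eps))
                        L)).
Proof.
pose c : R := 4 * (ln 26 + (2 + eps) * ln (4 * (2 + eps))).
pose big (n : nat) : bool :=
  [&& 1 <= ln (n%:R : R), 52 <= ln (n%:R : R) `^ eps & c <= ln (n%:R : R)].
(* The quotient in the limit is eventually (ln n)^eps. For small n the value 0 makes the probability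
   bound trivial. *)
exists (fun n => if big n then n%:R * ln (n%:R : R) `^ (2 + eps) else 0); split.
  have powR_ln_ge (A : R) : \forall n \near \oo,
      A <= ln (n%:R : R) /\ A <= ln (n%:R : R) `^ eps.
    (* ln n >= B gives both bounds at once; the absolute value keeps the base of the power
       nonnegative. *)
    pose B : R := Num.max `|A| (`|A| `^ eps^-1).
    have B0 : 0 <= B by rewrite le_max normr_ge0.
    have BA : `|A| <= B by rewrite le_max lexx.
    have BA' : `|A| `^ eps^-1 <= B by rewrite le_max lexx orbT.
    near=> n.
    have nB : expR B <= n%:R by near: n; exact: nbhs_infty_ger.
    have n0 : 0 < n%:R :> R by apply: lt_le_trans nB; exact: expR_gt0.
    have lnB : B <= ln (n%:R : R) by rewrite -ler_expR lnK ?posrE.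
    split; first exact: le_trans (le_trans (ler_norm A) BA) lnB.
    apply: le_trans (ler_norm A) _.
    have -> : `|A| = (`|A| `^ eps^-1) `^ eps.
      by rewrite -powRrM mulVf ?powRr1 // lt0r_neq0.
    apply: ge0_ler_powR; rewrite ?nnegrE ?powR_ge0 //.
    - exact: ltW.
    - exact: le_trans B0 lnB.
    - exact: le_trans BA' lnB.
  apply/cvgryPge => A; near=> n.
  have [l1 _] : 1 <= ln (n%:R : R) /\ 1 <= ln (n%:R : R) `^ eps.
    by near: n; exact: powR_ln_ge.
  have [_ l52] : 52 <= ln (n%:R : R) /\ 52 <= ln (n%:R : R) `^ eps.
    by near: n; exact: powR_ln_ge.
  have [lc _] : c <= ln (n%:R : R) /\ c <= ln (n%:R : R) `^ eps.
    by near: n; exact: powR_ln_ge.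
  have [_ lA] : A <= ln (n%:R : R) /\ A <= ln (n%:R : R) `^ eps.
    by near: n; exact: powR_ln_ge.
  have l0 : 0 < ln (n%:R : R) by exact: lt_le_trans l1.
  (* [ln] takes the default value 0 at 0, so a positive logarithm excludes n = 0. *)
  have n0 : n%:R != 0 :> R.
    by apply: contraTneq l0 => ->; rewrite ln0 // ltxx.
  rewrite /big l1 l52 lc powRD ?(gt_eqF l0) ?implybT // powR_mulrn ?(ltW l0) //.
  suff -> : n%:R * (ln n%:R ^+ 2 * ln n%:R `^ eps) / (n%:R * ln n%:R ^+ 2) =
    ln n%:R `^ eps :> R by [].
  by rewrite mulrA mulrAC mulfV ?mul1r // mulf_neq0 // expf_neq0 // gt_eqF.
move=> n n0; case: ifPn => [/and3P[l1 l52 lc]|_]; last first.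
  by rewrite oppr0 expR0 subrr divr_ge0 ?ler0n.
set D := (X in expR X); have -> : D = 3 * n%:R + (D - 3 * n%:R) by ring.
apply: prob_no_large_subsquare_ge => m m0 mn xm.
by rewrite lerBrDl; apply: subsquare_exponent_le.
Unshelve. all: by end_near.
Qed.
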